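(* Let $A$ be a real symmetric positive definite $n\times n$ matrix with at least four distinct eigenvalues, and let $\mathcal{E}_A=\{x\in\mathbb{R}^n:\langle A^{-1}x,x\rangle=1\}$, equipped with the Riemannian metric induced from $\mathbb{R}^n$. Then $\mathcal{E}_A$ has no self-focal points.
   Context: A point $x_0$ of a Riemannian manifold $M$ is self-focal if there exists a time $T>0$ such that $\exp_{x_0}(T\xi)=x_0$ for all unit (co)vectors $\xi\in S^*_{x_0}M$ (vectors and covectors are identified by the metric). *)

(* Defs.v *)
From mathcomp Require Import all_boot all_order all_algebra.
From mathcomp Require Import all_classical all_reals topology normedtype derive.
Import numFieldNormedType.Exports.

Set Implicit Arguments.
Unset Strict Implicit.
Unset Printing Implicit Defensive.

Import Order.TTheory GRing.Theory Num.Theory.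
Local Open Scope classical_set_scope.
Local Open Scope ring_scope.

(* The norm that MathComp-Analysis puts on 'cV[R]_n is the sup norm; it is used
   below only for the (equivalent) topology underlying derivatives.  All metric
   notions go through the Euclidean inner product [dot]. *)
Definition dot (R : realType) (n : nat) (u v : 'cV[R]_n) : R :=
  \sum_(i < n) u i 0 * v i 0.

Definition posdef_mx (R : realType) (n : nat) (A : 'M[R]_n) : Prop :=
  forall v : 'cV[R]_n, v != 0 -> 0 < dot (A *m v) v.

Definition ellipsoid (R : realType) (n : nat) (A : 'M[R]_n) : set 'cV[R]_n :=
  [set x | dot (invmx A *m x) x = 1].

(* T_x M for a submanifold M of R^n: velocities at x of curves drawn on M. *)
Definition tangent_space (R : realType) (n : nat) (M : set 'cV[R]_n)
    (x : 'cV[R]_n) : set 'cV[R]_n :=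
  [set v | exists c : R -> 'cV[R]_n,
    [/\ forall t, M (c t), c 0 = x, derivable c 0 1 & derive1 c 0 = v]].

(* For the metric induced from R^n, the Levi-Civita covariant derivative of a
   vector field V along a curve in M is the orthogonal projection of V' onto TM.
   Hence the geodesic equation (D/dt) g' = 0 says that the acceleration of g has
   no tangential component.  Geodesics are required on all of R, as is
   appropriate for complete M, and may have any constant speed. *)
Definition geodesic (R : realType) (n : nat) (M : set 'cV[R]_n)
    (g : R -> 'cV[R]_n) : Prop :=
  [/\ forall t, M (g t),
      forall t, derivable g t 1,
      forall t, derivable (derive1 g) t 1 &
      forall t w, tangent_space M (g t) w -> dot (derive1 (derive1 g) t) w = 0].

(* The graph of the exponential map: [is_exp M x v y] means exp_x(v) = y. *)
Definition is_exp (R : realType) (n : nat) (M : set 'cV[R]_n)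
    (x v y : 'cV[R]_n) : Prop :=
  exists g : R -> 'cV[R]_n,
    [/\ geodesic M g, g 0 = x, derive1 g 0 = v & g 1 = y].

Definition unit_tangent (R : realType) (n : nat) (M : set 'cV[R]_n)
    (x : 'cV[R]_n) : set 'cV[R]_n :=
  [set xi | tangent_space M x xi /\ dot xi xi = 1].

Definition self_focal (R : realType) (n : nat) (M : set 'cV[R]_n)
    (x0 : 'cV[R]_n) : Prop :=
  M x0 /\
  exists T : R, 0 < T /\
    forall xi : 'cV[R]_n, unit_tangent M x0 xi -> is_exp M x0 (T *: xi) x0.

(* Main.v *)
(** In coordinates along orthonormal eigenvectors, a geodesic satisfies the Hill
    equations [x_j'' = - (lam / a_j) x_j] with one common [lam > 0], and has Moser's
    first integrals [F_k].  Suppose that all geodesics of speed [T] from [u] are back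
    at [u] at time [1].

    If [u_k <> 0] for an eigenvalue [a_k] that is neither minimal nor maximal, then
    [F_k] vanishes at some velocity [v] at [u].  On [F_k = 0] there is a function
    [kappa] of position and velocity that strictly decreases along the flow, and at
    [u] it is linear in the velocity.  Each return to [u] keeps [F_k = 0] and lowers
    [kappa] by a fixed amount, although [kappa] is bounded on velocities of norm [T].

    Otherwise [u] lies on an ellipse [E] in a plane spanned by eigenvectors for the
    two extreme eigenvalues.  Let [a_k] be an intermediate eigenvalue and perturb the
    geodesic [E] in the direction [k].  To first order [x_k] solves a Hill equation
    along [E] one of whose solutions is known explicitly: a linear form [l] vanishing
    at two umbilic-like points, times a strictly monotone exponential factor.  Since
    [x_k] vanishes and [|x_k'|] is the same at times [0] and [1], the Wronskian forces
    [l(u) = 0].  This determines [a_k] from [u], which is impossible as there are at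
    least two intermediate eigenvalues. *)

Require Import Defs.
From mathcomp Require Import all_boot all_order all_algebra.
From mathcomp Require Import sesquilinear spectral complex ring lra.
From mathcomp Require Import all_classical all_reals topology normedtype derive.
From mathcomp Require Import sequences realfun exp.
Import numFieldNormedType.Exports.
Import Order.TTheory GRing.Theory Num.Theory.

Set Implicit Arguments.
Unset Strict Implicit.
Unset Printing Implicit Defensive.

Local Open Scope classical_set_scope.
Local Open Scope ring_scope.

(** * Spectral theorem for real symmetric matrices *)

(** Over the complexification [A] is Hermitian, so the complex spectral theorem gives a real
    diagonal entry. It is a root of the characteristic polynomial, whose coefficients already lie in
    [R]. *)
Lemma symmetric_has_eigenvalue (R : rcfType) (n : nat) (A : 'M[R]_n.+1) :
  A^T = A -> exists a, eigenvalue A a.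
Proof.
move=> symA; pose f := real_complex R.
pose AC := map_mx f A.
have ACreal : AC \is a mxOver Num.real.
  apply/mxOverP => i j; rewrite mxE /f.
  by rewrite complex_real.
have ACsym : AC \is hermitianmx _ false idfun.
  apply/is_hermitianmxP; rewrite expr0 scale1r map_mx_id //.
  by rewrite /AC map_trmx symA.
have Aherm := realsym_hermsym ACsym ACreal.
have spreal := hermitian_spectral_diag_real Aherm.
have /orthomx_spectralP := hermitian_normalmx Aherm.
set P := spectralmx AC; set D := spectral_diag AC => ACE.
have Pu : P \in unitmx by apply: spectral_unit.
have Deig : eigenvalue AC (D 0 0).
  apply/eigenvalueP; exists (row 0 P); last first.
    by apply/eqP => P0; move: Pu; rewrite -row_free_unit => /row_freeP [Q PQ];
      have := congr1 (row 0) PQ; rewrite row_mul P0 mul0mx => /matrixP/(_ 0 0);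
      rewrite !mxE eqxx => /esym/eqP; rewrite oner_eq0.
  rewrite ACE -row_mul !mulmxA mulmxV // mul1mx.
  by apply/rowP => j; rewrite !mxE (bigD1 0) //= big1 ?addr0 => [|i ni];
    rewrite !mxE ?eqxx ?mulr1n // eq_sym (negbTE ni) mulr0n mul0r.
have [r Dr] : exists r, D 0 0 = f r.
  by have /mxOverP/(_ 0 0)/complex_realP[r ->] := spreal; exists r.
exists r; move: Deig; rewrite Dr !eigenvalue_root_char.
by rewrite /AC /f -map_char_poly fmorph_root.
Qed.

(** [H] is the reflection in the hyperplane orthogonal to [v - e], which exchanges the unit vectors
    [v] and [e]. *)
Lemma householder_first_row (R : realFieldType) (n : nat) (v : 'rV[R]_n.+1) :
  v *m v^T = 1%:M ->
  exists H : 'M[R]_n.+1, H *m H^T = 1%:M /\ row 0 H = v.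
Proof.
move=> vv; pose e : 'rV[R]_n.+1 := delta_mx 0 0; pose u := v - e.
(* If [v] is the first basis vector then [u = 0], so [c = 2 / 0 = 0] and [H] is 1. *)
pose c := 2 / (u *m u^T) 0 0.
have ee : e *m e^T = 1%:M.
  by rewrite /e trmx_delta mul_delta_mx; apply/matrixP=> i j; rewrite !ord1 !mxE.
have ve : v *m e^T = (v 0 0)%:M.
  rewrite /e trmx_delta -colE; apply/matrixP=> i j.
  by rewrite !ord1 !mxE /= mulr1n.
have ev : e *m v^T = (v 0 0)%:M.
  by apply: trmx_inj; rewrite trmx_mul trmxK ve tr_scalar_mx.
have uu : u *m u^T = (2 * (1 - v 0 0))%:M.
  rewrite /u linearB /= mulmxBl !mulmxBr vv ee ve ev.
  apply/matrixP=> i j; rewrite !ord1 !mxE /= mulr1n; ring.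
have uE : (u *m u^T) 0 0 = 2 * (1 - v 0 0) by rewrite uu mxE mulr1n.
have u0 : u 0 0 = v 0 0 - 1 by rewrite !mxE eqxx.
(* The property of [c] from which [H *m H^T = 1%:M] follows; in this form it also covers [u = 0]. *)
have cuu : c * (c * (u *m u^T) 0 0) = 2 * c.
  rewrite /c; have [->|nz] := eqVneq ((u *m u^T) 0 0) 0; first by rewrite invr0; ring.
  by field.
pose H := 1%:M - c *: (u^T *m u).
have Hsym : H^T = H by rewrite /H linearB /= linearZ /= trmx_mul trmxK trmx1.
exists H; split.
  rewrite Hsym /H; move: uu uE cuu; move: (c) => k; clear -u; move: (u) => w uu uE cuu.
  rewrite mulmxBl mul1mx mulmxBr mulmx1 -scalemxAl -scalemxAr.
  rewrite -mulmxA (mulmxA w) uu mul_scalar_mx -scalemxAr -uE scalerA.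
  rewrite scalerA mulrA in cuu *.
  rewrite cuu mulrDl mul1r scalerDl opprB.
  by apply/matrixP=> i j; rewrite !mxE; ring.
apply/rowP=> j.
have -> : row 0 H 0 j = (j == 0)%:R - c * (u 0 0 * u 0 j).
  rewrite /H; move: (u) (c) => w k; rewrite !mxE big_ord1 !mxE.
  by rewrite [_ == 0]eq_sym.
have uj : u 0 j = v 0 j - (j == 0)%:R by rewrite !mxE eqxx.
have [v1|v1] := eqVneq (v 0 0) 1; last first.
  have nz : 1 - v 0 0 != 0 by rewrite subr_eq0 eq_sym.
  by rewrite uj u0 /c uE; field.
have u_eq0 : u = 0.
  apply/rowP=> k; rewrite [RHS]mxE.
  have : (u *m u^T) 0 0 = 0 by rewrite uE v1 subrr mulr0.
  rewrite mxE => /eqP; rewrite psumr_eq0 => [/allP/(_ k)|i _]; last first.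
    by rewrite [u^T _ _]mxE -expr2 sqr_ge0.
  rewrite mem_index_enum => /(_ isT) /eqP; rewrite [u^T _ _]mxE => /eqP.
  by rewrite mulf_eq0 orbb => /eqP.
by move: uj; rewrite u_eq0 !mxE => /esym/eqP; rewrite subr_eq0 => /eqP ->; ring.
Qed.

(** Induction by deflation: in an orthonormal basis starting with a unit eigenvector, symmetry makes
    the matrix block diagonal with a smaller symmetric block. *)
Lemma symmetric_spectral (R : rcfType) (n : nat) (A : 'M[R]_n) :
  A^T = A -> exists (P : 'M[R]_n) (d : 'rV[R]_n),
    P *m P^T = 1%:M /\ A = P^T *m diag_mx d *m P.
Proof.
elim: n A => [|n IH] A symA.
  by exists 1%:M, 0; split; apply/matrixP => -[].
have [a /eigenvalueP[v0 v0A v0n]] := symmetric_has_eigenvalue symA.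
pose r := Num.sqrt ((v0 *m v0^T) 0 0); pose v := r^-1 *: v0.
have r2 : r ^+ 2 = (v0 *m v0^T) 0 0.
  rewrite sqr_sqrtr // mxE sumr_ge0 // => i _.
  by rewrite [v0^T _ _]mxE -expr2 sqr_ge0.
have rn : r != 0.
  apply/eqP=> r0; move: r2; rewrite r0 expr0n /= => /esym/eqP.
  rewrite mxE psumr_eq0 => [/allP al|i _]; last by rewrite [v0^T _ _]mxE -expr2 sqr_ge0.
  case/eqP: v0n; apply/rowP=> k; rewrite [RHS]mxE.
  have := al k; rewrite mem_index_enum => /(_ isT).
  by rewrite [v0^T _ _]mxE mulf_eq0 orbb => /eqP.
have vA : v *m A = a *: v by rewrite -scalemxAl v0A !scalerA mulrC.
have vv : v *m v^T = 1%:M.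
  rewrite /v linearZ /= -scalemxAl -scalemxAr scalerA.
  by apply/matrixP=> i j; rewrite !ord1 mxE -r2 mxE /= mulr1n; field.
have [H [HH H0]] := householder_first_row vv.
have HtH : H^T *m H = 1%:M by apply: mulmx1C.
pose B : 'M[R]_(1 + n) := H *m A *m H^T.
have BE : B = H *m A *m H^T by [].
have Bsym : B^T = B by rewrite /B !trmx_mul trmxK symA mulmxA.
have B0 : row 0 B = a *: delta_mx 0 0.
  by rewrite /B !row_mul H0 vA -scalemxAl -H0 -row_mul HH row1.
have B0j j : B 0 j = a * (j == 0)%:R.
  by have := congr1 (fun w : 'rV_n.+1 => w 0 j) B0; rewrite !mxE eqxx.
clearbody B.
have Bul : ulsubmx B = a%:M.
  apply/matrixP=> i j; rewrite !ord1 !mxE mulr1n.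
  by have := B0j 0; rewrite eqxx mulr1 => <-; congr (B _ _); apply: val_inj.
have Bur : ursubmx B = 0.
  apply/matrixP=> i j; rewrite ord1 [RHS]mxE 2!mxE -[RHS](mulr0 a).
  rewrite -[X in _ = _ * X]/((rshift 1 j == 0)%:R : R).
  by rewrite -B0j; congr (B _ _); apply: val_inj.
have Bdl : dlsubmx B = 0.
  by rewrite -Bsym -trmx_ursub Bur trmx0.
have [|P' [d' [PP' Ad]]] := IH (drsubmx B).
  by rewrite trmx_drsub Bsym.
pose P0 : 'M[R]_(1 + n) := block_mx 1%:M 0 0 P'.
pose d : 'rV[R]_(1 + n) := row_mx (const_mx a) d'.
have PP0 : P0 *m P0^T = 1%:M.
  rewrite /P0 tr_block_mx mulmx_block !trmx0 trmx1 !mulmx0 !mul0mx !mulmx1 !addr0 !add0r PP'.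
  by rewrite -scalar_mx_block.
have Bd : B = P0^T *m diag_mx d *m P0.
  rewrite -[B]submxK Bul Bur Bdl Ad /P0 tr_block_mx /d diag_mx_row.
  rewrite !mulmx_block !trmx0 trmx1 !mulmx0 !mul0mx !addr0 !add0r !mul1mx !mulmx1 ?mulmx0 ?mul0mx.
  congr block_mx; apply/matrixP=> i j; by rewrite !mxE !ord1.
exists (P0 *m H), d; split.
  by rewrite trmx_mul mulmxA -(mulmxA P0) HH mulmx1 PP0.
rewrite trmx_mul !mulmxA -2!(mulmxA (H^T)) -(mulmxA _ _ P0).
rewrite (mulmxA (P0^T)) -Bd BE !mulmxA HtH mul1mx -mulmxA HtH mulmx1 //.
Qed.

(** * Derivatives of real functions *)

Section DerivativeRules.
Variable R : realType.
Implicit Types (f g : R -> R) (t a b : R).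

Lemma derC t a : is_derive t 1 (fun _ => a) (0 : R).
Proof. exact: is_derive_cst. Qed.

Lemma derI t : is_derive t 1 (fun t : R => t) (1 : R).
Proof. exact: is_derive_id. Qed.

Lemma derD f g t a b : is_derive t 1 f a -> is_derive t 1 g b ->
  is_derive t 1 (fun t => f t + g t) (a + b).
Proof. exact: is_deriveD. Qed.

Lemma derN f t a : is_derive t 1 f a -> is_derive t 1 (fun t => - f t) (- a).
Proof. exact: is_deriveN. Qed.

Lemma derM f g t a b : is_derive t 1 f a -> is_derive t 1 g b ->
  is_derive t 1 (fun t => f t * g t) (a * g t + f t * b).
Proof.
move=> fa gb; apply: (is_derive_eq (is_deriveM fa gb)).
by rewrite /GRing.scale /= addrC mulrC.
Qed.

Lemma derV f t a : f t != 0 -> is_derive t 1 f a ->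
  is_derive t 1 (fun t => (f t)^-1) (- a / f t ^+ 2).
Proof.
move=> f0 [df fa]; apply: DeriveDef; first exact: derivableV.
by rewrite deriveV // fa /GRing.scale /= mulrC mulrN mulNr.
Qed.

Lemma der_sum (I : Type) (r : seq I) (P : pred I) (f : I -> R -> R) (df : I -> R) t :
  (forall i, is_derive t 1 (f i) (df i)) ->
  is_derive t 1 (fun t => \sum_(i <- r | P i) f i t) (\sum_(i <- r | P i) df i).
Proof.
move=> H; elim: r => [|i r IH].
  rewrite big_nil; under [X in is_derive _ _ X]eq_fun do rewrite big_nil.
  exact: derC.
rewrite big_cons; under [X in is_derive _ _ X]eq_fun do rewrite big_cons.
by case: (P i) => //; apply: derD.
Qed.

Lemma der_eq f t a b : is_derive t 1 f a -> a = b -> is_derive t 1 f b.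
Proof. by move=> h <-. Qed.

End DerivativeRules.

Ltac der_step := first
  [ eassumption
  | match goal with H : forall t, is_derive t 1 _ _ |- _ =>
      notypeclasses refine (H _) end
  | match goal with H : forall j, is_derive ?t 1 _ _ |- is_derive ?t 1 _ _ =>
      notypeclasses refine (H _) end
  | match goal with H : forall j t, is_derive t 1 _ _ |- _ =>
      notypeclasses refine (H _ _) end
  | notypeclasses refine (derC _ _) | notypeclasses refine (derI _)
  | notypeclasses refine (derD _ _) | notypeclasses refine (derN _)
  | notypeclasses refine (derM _ _) | notypeclasses refine (derV _ _)
  | notypeclasses refine (der_sum _ _ _); intros ? ].
(** Builds the derivative from the syntax of the function and leaves the goal that it equals the
    stated value. *)
Ltac der := notypeclasses refine (der_eq _ _); [repeat der_step | cbv beta].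

(** * Monotonicity and Gronwall's inequality *)

Section Monotone.
Variable R : realType.
Implicit Types (f df : R -> R).

Lemma der_continuous f df : (forall t : R, is_derive t 1 f (df t)) -> continuous f.
Proof.
move=> H t; apply: differentiable_continuous.
by apply/derivable1_diffP; have [] := H t.
Qed.

Lemma der_MVT f df a b : a <= b ->
  (forall t : R, a <= t <= b -> is_derive t 1 f (df t)) ->
  exists c, a <= c <= b /\ f b - f a = df c * (b - a).
Proof.
move=> ab H; have fc : {within `[a, b], continuous f}.
  apply: continuous_in_subspaceT => t; rewrite inE /= in_itv /= => /H [df1 _].
  by apply: differentiable_continuous; apply/derivable1_diffP.
have Hoo t : t \in `]a, b[ -> is_derive t 1 f (df t).
  by rewrite in_itv /= => /andP[at_ tb]; apply: H; rewrite !ltW.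
have [c] := MVT_segment ab Hoo fc.
by rewrite in_itv /= => cab E; exists c.
Qed.

Lemma der_le0_le f df a b : a <= b ->
  (forall t : R, a <= t <= b -> is_derive t 1 f (df t)) ->
  (forall t, a <= t <= b -> df t <= 0) -> f b <= f a.
Proof.
move=> ab H le0; have [c [/le0 dfc E]] := der_MVT ab H.
by rewrite -subr_le0 E mulr_le0_ge0 // subr_ge0.
Qed.

Lemma der0_cst f : (forall t : R, is_derive t 1 f 0) -> forall s t, f s = f t.
Proof. by move=> H s t; apply: is_derive_0_is_cst. Qed.

(** [f t * expR (- K * t)] has nonpositive derivative. Applied to functions of either sign, this
    also yields lower bounds. *)
Lemma gronwall f df K T : 0 <= T ->
  (forall t : R, 0 <= t <= T -> is_derive t 1 f (df t)) ->
  (forall t, 0 <= t <= T -> df t <= K * f t) -> f T <= f 0 * expR (K * T).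
Proof.
move=> T0 H le.
have He (t : R) : is_derive t 1 (fun t => expR (- K * t)) (- K * expR (- K * t)).
  have := @is_derive1_comp _ expR (fun t => - K * t) t _ _ (is_derive_expR _).
  move=> /(_ (- K)) h; apply: is_derive_eq (h _) _; last by rewrite mulrC.
  by der; ring.
have HF (t : R) : 0 <= t <= T -> is_derive t 1 (fun t => f t * expR (- K * t))
    ((df t - K * f t) * expR (- K * t)).
  by move=> /H Ht; der; ring.
have := der_le0_le T0 HF.
rewrite mulr0 expR0 mulr1 => h.
rewrite -ler_pdivrMr ?expR_gt0 // -expRN -mulNr; apply: h => t /le ft.
by rewrite mulr_le0_ge0 ?expR_ge0 // subr_le0.
Qed.

Lemma continuous_neq0_gt0 f T : continuous f -> 0 <= T ->
  (forall t : R, 0 <= t <= T -> f t != 0) -> 0 < f 0 -> 0 < f T.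
Proof.
move=> cf T0 nz f0; rewrite ltNge; apply/negP => fT.
have [| |c cT fc] := @IVT _ f 0 T 0 T0.
- by apply: continuous_subspaceT => x; apply: cf.
- by rewrite ge_min fT orbT le_max (ltW f0).
by move: cT; rewrite in_itv /= => /nz; rewrite fc eqxx.
Qed.

End Monotone.

(** * Geodesic flow in eigencoordinates *)

(* Speed-[c] geodesics in eigencoordinates: [x] is the position, [y] the velocity and
   the [a j] are the eigenvalues of [A], repeated with multiplicity. *)
Definition ellipsoid_flow (R : realType) (n : nat) (a : 'I_n -> R) (c : R)
    (x y : 'I_n -> R -> R) (lam : R -> R) : Prop :=
  [/\ forall j (t : R), is_derive t 1 (x j) (y j t),
      forall j (t : R), is_derive t 1 (y j) (- (lam t / a j) * x j t),
      forall t, \sum_j x j t ^+ 2 / a j = 1,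
      forall t, \sum_j y j t ^+ 2 = c ^+ 2 &
      forall t, lam t = (\sum_j y j t ^+ 2 / a j) / (\sum_j x j t ^+ 2 / a j ^+ 2)].

(** * Energy estimates for Hill's equation *)

Section HillEquation.
Variables (R : realType) (b L : R) (lam X Y : R -> R).
Hypotheses (b_gt0 : 0 < b) (lam_bd : forall t, `|lam t| <= L).
Hypothesis dX : forall t : R, is_derive t 1 X (Y t).
Hypothesis dY : forall t : R, is_derive t 1 Y (- (lam t / b) * X t).

Let dE (t : R) : is_derive t 1 (fun t => X t ^+ 2 + Y t ^+ 2)
  (2 * X t * Y t * (1 - lam t / b)).
Proof. by der; field; rewrite gt_eqF. Qed.

Let dE_bd t : `|2 * X t * Y t * (1 - lam t / b)| <= (1 + L / b) * (X t ^+ 2 + Y t ^+ 2).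
Proof.
rewrite normrM mulrC ler_pM //.
  rewrite (le_trans (ler_normB _ _)) // normr1 lerD2l normrM.
  by rewrite (ger0_norm (x := b^-1)) ?invr_ge0 ?(ltW b_gt0) // ler_pM2r ?invr_gt0.
rewrite ler_norml; apply/andP; split.
- by rewrite -subr_ge0; have := sqr_ge0 (X t + Y t); nra.
- by rewrite -subr_ge0; have := sqr_ge0 (X t - Y t); nra.
Qed.

Lemma hill_energy_le T : 0 <= T ->
  X T ^+ 2 + Y T ^+ 2 <= (X 0 ^+ 2 + Y 0 ^+ 2) * expR ((1 + L / b) * T).
Proof.
move=> T0; apply: (gronwall T0 (fun t _ => dE t)) => t _.
exact: le_trans (ler_norm _) (dE_bd t).
Qed.

Lemma hill_energy_ge T : 0 <= T ->
  (X 0 ^+ 2 + Y 0 ^+ 2) * expR (- (1 + L / b) * T) <= X T ^+ 2 + Y T ^+ 2.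
Proof.
move=> T0.
have dN (t : R) : is_derive t 1 (fun t => - (X t ^+ 2 + Y t ^+ 2))
  (- (2 * X t * Y t * (1 - lam t / b))).
  exact: derN.
rewrite -lerN2 -mulNr; apply: (gronwall T0 (fun t _ => dN t)) => t _.
by rewrite mulrN mulNr opprK; apply: le_trans (dE_bd t); rewrite -normrN ler_norm.
Qed.

Lemma hill_unique : X 0 = 0 -> Y 0 = 0 -> forall t, 0 <= t -> X t = 0 /\ Y t = 0.
Proof.
move=> X0 Y0 t /hill_energy_le; rewrite X0 Y0 expr0n addr0 mul0r => h.
have [hX hY] := (sqr_ge0 (X t), sqr_ge0 (Y t)).
by split; apply/eqP; rewrite -sqrf_eq0; lra.
Qed.

(** By the lower energy bound. This makes [x_k^2 + y_k^2] available as a denominator when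
    [u_k <> 0]. *)
Lemma hill_energy_gt0 : X 0 != 0 -> forall t, 0 <= t -> 0 < X t ^+ 2 + Y t ^+ 2.
Proof.
move=> X0 t /hill_energy_ge; apply: lt_le_trans.
by rewrite mulr_gt0 ?expR_gt0 // ltr_wpDr ?sqr_ge0 // exprn_even_gt0.
Qed.

End HillEquation.

(** * Bounds and Wronskians along the flow *)

Section Flow.
Variables (R : realType) (n : nat) (a : 'I_n -> R) (amin amax c : R).
Hypotheses (amin_gt0 : 0 < amin) (a_bd : forall j, amin <= a j <= amax).
Variables (x y : 'I_n -> R -> R) (lam : R -> R).
Hypothesis flow : ellipsoid_flow a c x y lam.
Hypothesis c_gt0 : 0 < c.

Let dx : forall j (t : R), is_derive t 1 (x j) (y j t). Proof. by case: flow. Qed.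
Let dy : forall j (t : R), is_derive t 1 (y j) (- (lam t / a j) * x j t).
Proof. by case: flow. Qed.
Let a_gt0 j : 0 < a j.
Proof. by have /andP[h _] := a_bd j; apply: lt_le_trans h. Qed.
Let a_neq0 j : a j != 0. Proof. by rewrite gt_eqF. Qed.

Lemma flow_tangent t : \sum_j x j t * y j t / a j = 0.
Proof.
have [_ _ x1 _ _] := flow.
have h1 : is_derive t 1 (fun t => \sum_j x j t ^+ 2 / a j)
    (2 * \sum_j x j t * y j t / a j).
  der; rewrite mulr_sumr; apply: eq_bigr => j _; field; exact: a_neq0.
have h2 : is_derive t 1 (fun t => \sum_j x j t ^+ 2 / a j) 0.
  by under [X in is_derive _ _ X]eq_fun do rewrite x1; exact: derC.
have [_ e1] := h1; have [_ e2] := h2.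
by move: e1; rewrite e2 => /esym/eqP; rewrite mulf_eq0 pnatr_eq0 => /eqP.
Qed.

Lemma flow_coord_le j t : x j t ^+ 2 <= amax.
Proof.
have [_ _ x1 _ _] := flow; have /andP[aj1 aj2] := a_bd j.
apply: le_trans aj2; rewrite -[leRHS]mulr1 -(x1 t) (bigD1 j) //= mulrDr.
rewrite mulrCA divff // mulr1 lerDl mulr_ge0 ?(ltW (a_gt0 j)) // sumr_ge0 // => i _.
by rewrite divr_ge0 ?sqr_ge0 // ltW.
Qed.

Lemma flow_speed_le j t : `|y j t| <= c.
Proof.
have [_ _ _ y1 _] := flow.
rewrite -(ler_pXn2r (n := 2)) ?nnegrE // ?(ltW c_gt0) // real_normK ?num_real //.
by rewrite -(y1 t) (bigD1 j) //= lerDl sumr_ge0 // => i _; rewrite sqr_ge0.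
Qed.

Let num_bd t : c ^+ 2 / amax <= \sum_j y j t ^+ 2 / a j <= c ^+ 2 / amin.
Proof.
have [_ _ _ y1 _] := flow; rewrite -(y1 t) !mulr_suml.
apply/andP; split; apply: ler_sum => j _; have /andP[aj1 aj2] := a_bd j;
  apply: ler_wpM2l; rewrite ?sqr_ge0 // lef_pV2 ?posrE //.
by apply: lt_le_trans (a_gt0 j) aj2.
Qed.

Lemma flow_den_bd t : amax^-1 <= \sum_j x j t ^+ 2 / a j ^+ 2 <= amin^-1.
Proof.
have [_ _ x1 _ _] := flow; rewrite -[amax^-1]mul1r -[amin^-1]mul1r -(x1 t) !mulr_suml.
apply/andP; split; apply: ler_sum => j _; have /andP[aj1 aj2] := a_bd j;
  rewrite expr2 invfM mulrA; apply: ler_wpM2l;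
  rewrite ?divr_ge0 ?sqr_ge0 ?(ltW (a_gt0 j)) // lef_pV2 ?posrE //.
by apply: lt_le_trans (a_gt0 j) aj2.
Qed.

Hypothesis amax_gt0 : 0 < amax.

Let den_gt0 t : 0 < \sum_j x j t ^+ 2 / a j ^+ 2.
Proof. by have /andP[h _] := flow_den_bd t; apply: lt_le_trans h; rewrite invr_gt0. Qed.

Lemma flow_lam_bd t : c ^+ 2 * amin / amax <= lam t <= c ^+ 2 * amax / amin.
Proof.
have [_ _ _ _ ->] := flow; have /andP[N1 N2] := num_bd t.
have /andP[D1 D2] := flow_den_bd t.
rewrite ler_pdivlMr // ler_pdivrMr //; apply/andP; split.
  apply: le_trans N1; rewrite [leLHS]mulrAC ler_pM2r ?invr_gt0 //.
  by rewrite -mulrA ler_piMr ?sqr_ge0 // mulrC -ler_pdivlMr // mul1r.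
apply: le_trans N2 _; rewrite [leRHS]mulrAC ler_pM2r ?invr_gt0 //.
by rewrite -mulrA ler_peMr ?sqr_ge0 // mulrC -ler_pdivrMr // mul1r.
Qed.

Lemma flow_lam_gt0 t : 0 < lam t.
Proof.
have /andP[h _] := flow_lam_bd t; apply: lt_le_trans h.
by rewrite !mulr_gt0 ?invr_gt0 // exprn_gt0.
Qed.

Lemma flow_lam_norm t : `|lam t| <= c ^+ 2 * amax / amin.
Proof. by have /andP[_ h] := flow_lam_bd t; rewrite ger0_norm // ltW // flow_lam_gt0. Qed.

(** Coordinates with the same eigenvalue solve the same Hill equation. Alignment of position and
    velocity inside an eigenspace therefore persists once it holds at time 0. *)
Lemma flow_wronskian i j : a i = a j -> forall t,
  x i t * y j t - x j t * y i t = x i 0 * y j 0 - x j 0 * y i 0.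
Proof.
move=> aij t; pose f t := x i t * y j t - x j t * y i t.
by apply: (der0_cst (f := f)) => s; rewrite /f; der; rewrite aij; ring.
Qed.

End Flow.

(** * Moser's first integrals *)

Section MoserIntegral.
Variables (R : realType) (n : nat) (a : 'I_n -> R) (k : 'I_n).
Implicit Types u v : 'I_n -> R.

Definition res_form u v : R := \sum_(j | a j != a k) u j * v j / (a k - a j).

(* [moser_integral u v = v_k^2 + \sum_j (u_k v_j - u_j v_k)^2 / (a_k - a_j)].  Eigenvalues
   equal to [a_k] are left out, so it is conserved only if the position and the velocity
   are aligned in that eigenspace. *)
Definition moser_p u v : R := (1 + res_form u u) * v k - res_form u v * u k.
Definition moser_q u v : R := res_form u v * v k - res_form v v * u k.
Definition moser_integral u v : R := v k * moser_p u v - u k * moser_q u v.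

Variables (c : R) (x y : 'I_n -> R -> R) (lam : R -> R).
Hypothesis flow : ellipsoid_flow a c x y lam.
Hypothesis a_gt0 : forall j, 0 < a j.
Hypothesis aligned : forall j t, a j = a k -> x k t * y j t = x j t * y k t.

Let dx : forall j (t : R), is_derive t 1 (x j) (y j t). Proof. by case: flow. Qed.
Let dy : forall j (t : R), is_derive t 1 (y j) (- (lam t / a j) * x j t).
Proof. by case: flow. Qed.
Let a_neq0 j : a j != 0. Proof. by rewrite gt_eqF. Qed.

Let X t j := x j t.
Let Y t j := y j t.
Let e0 t := \sum_(j | a j == a k) x j t ^+ 2.
Let e1 t := \sum_(j | a j == a k) x j t * y j t.

Let e01 t : x k t * e1 t = y k t * e0 t.
Proof.
rewrite /e1 /e0 !mulr_sumr; apply: eq_bigr => j /eqP ajk.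
by rewrite mulrCA aligned //; ring.
Qed.

(** Partial fractions: [1 / (a_j (a_k - a_j)) = (1 / a_j + 1 / (a_k - a_j)) / a_k]. The factor
    [1 / a_j] coming from the Hill equations is thereby traded for the constraint sums [offE0] and
    [offE1]. *)
Lemma res_form_div u v :
  \sum_(j | a j != a k) u j * v j / a j / (a k - a j) =
  ((\sum_(j | a j != a k) u j * v j / a j) + res_form u v) / a k.
Proof.
rewrite -big_split /= mulr_suml; apply: eq_bigr => j ajk.
have : a k - a j != 0 by rewrite subr_eq0 eq_sym.
by move=> h; field; rewrite h !a_neq0.
Qed.

Let offE0 t : \sum_(j | a j != a k) x j t * x j t / a j = 1 - e0 t / a k.
Proof.
have [_ _ x1 _ _] := flow; have := x1 t; rewrite (bigID (fun j => a j == a k)) /=.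
have -> : \sum_(j | a j == a k) x j t ^+ 2 / a j = e0 t / a k.
  by rewrite /e0 mulr_suml; apply: eq_bigr => j /eqP ->.
by move=> <-; rewrite addrC addrK.
Qed.

Hypothesis tangent : forall t, \sum_j x j t * y j t / a j = 0.

Let offE1 t : \sum_(j | a j != a k) x j t * y j t / a j = - (e1 t / a k).
Proof.
have := tangent t; rewrite (bigID (fun j => a j == a k)) /=.
have -> : \sum_(j | a j == a k) x j t * y j t / a j = e1 t / a k.
  by rewrite /e1 mulr_suml; apply: eq_bigr => j /eqP ->.
by move/eqP; rewrite addr_eq0 => /eqP ->; rewrite opprK.
Qed.

Let dG0 (t : R) : is_derive t 1 (fun t => res_form (X t) (X t)) (2 * res_form (X t) (Y t)).
Proof.
rewrite /res_form; der.
by rewrite mulr_sumr; apply: eq_bigr => j _; rewrite /X /Y; ring.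
Qed.

Let dG1 (t : R) : is_derive t 1 (fun t => res_form (X t) (Y t))
  (res_form (Y t) (Y t) - lam t / a k * (1 - e0 t / a k + res_form (X t) (X t))).
Proof.
rewrite -offE0 mulrAC -mulrA -res_form_div /res_form; der.
rewrite mulr_sumr -sumrB; apply: eq_bigr => j _; rewrite /X /Y.
by ring.
Qed.

Let dG2 (t : R) : is_derive t 1 (fun t => res_form (Y t) (Y t))
  (- (2 * (lam t / a k * (res_form (X t) (Y t) - e1 t / a k)))).
Proof.
rewrite addrC -offE1 [lam t / _ * _]mulrAC -[lam t * _ / _]mulrA -res_form_div /res_form; der.
rewrite !mulr_sumr -sumrN; apply: eq_bigr => j _; rewrite /X /Y.
by ring.
Qed.

(** With [eps = lam e0 / a_k^2], the pair [(p, q)] solves the system of [(x_k, y_k)] up to the term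
    [- eps (x_k, y_k)]: [p' = q - eps x_k] and [q' = - (lam / a_k) p - eps y_k]. Hence the Moser
    integral, which is the Wronskian of the two pairs, is constant, and [(p, q) = kap (x_k, y_k)]
    gives [kap' = - eps]. *)
Lemma moser_p_derive (t : R) : is_derive t 1 (fun t => moser_p (X t) (Y t))
  (moser_q (X t) (Y t) - lam t / a k ^+ 2 * e0 t * x k t).
Proof.
have := dG0 t; have := dG1 t; rewrite /moser_p /moser_q => h1 h0; der.
by rewrite /X /Y; field; exact: a_neq0.
Qed.

Lemma moser_q_derive (t : R) : is_derive t 1 (fun t => moser_q (X t) (Y t))
  (- (lam t / a k) * moser_p (X t) (Y t) - lam t / a k ^+ 2 * e0 t * y k t).
Proof.
have := dG1 t; have := dG2 t; rewrite /moser_p /moser_q => h1 h0; der.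
have h : x k t * e1 t = y k t * e0 t := e01 t.
rewrite /X /Y.
apply/eqP; rewrite -subr_eq0; apply/eqP.
transitivity ((2 * lam t / a k ^+ 2) * (y k t * e0 t - x k t * e1 t)); last by rewrite h subrr mulr0.
by field; exact: a_neq0.
Qed.

Lemma moser_integral_const s t :
  moser_integral (X s) (Y s) = moser_integral (X t) (Y t).
Proof.
apply: (der0_cst (f := fun t => moser_integral (X t) (Y t))) => r.
have := moser_p_derive r; have := moser_q_derive r.
rewrite /moser_integral => hq hp; der.
by rewrite /X /Y; field; exact: a_neq0.
Qed.

End MoserIntegral.

Section ResForm.
Variables (R : realType) (n : nat) (a : 'I_n -> R) (k : 'I_n).
Implicit Types u v w : 'I_n -> R.

Lemma res_formC u v : res_form a k u v = res_form a k v u.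
Proof. by apply: eq_bigr => j _; rewrite [u j * _]mulrC. Qed.

Lemma res_form_combl p q u v w :
  res_form a k (fun j => p * u j + q * v j) w =
  p * res_form a k u w + q * res_form a k v w.
Proof.
by rewrite /res_form !mulr_sumr -big_split; apply: eq_bigr => j _ /=; ring.
Qed.

Lemma res_form_comb p q u v :
  res_form a k (fun j => p * u j + q * v j) (fun j => p * u j + q * v j) =
  p ^+ 2 * res_form a k u u + 2 * p * q * res_form a k u v + q ^+ 2 * res_form a k v v.
Proof.
by rewrite /res_form !mulr_sumr -!big_split; apply: eq_bigr => j _ /=; ring.
Qed.

Lemma moser_integralZ s u v :
  moser_integral a k u (fun j => s * v j) = s ^+ 2 * moser_integral a k u v.
Proof.
have e : (fun j => s * v j) = (fun j => s * v j + 0 * v j).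
  by apply/funext => j; rewrite mul0r addr0.
rewrite /moser_integral /moser_p /moser_q e res_form_comb res_formC res_form_combl.
by rewrite (res_formC v u); ring.
Qed.

End ResForm.

(** * Null velocities of a Moser integral *)

Section NullDirection.
Variables (R : realType) (n : nat) (a : 'I_n -> R) (u : 'I_n -> R) (i k l : 'I_n).
Hypothesis a_gt0 : forall j, 0 < a j.
Hypothesis u1 : \sum_j u j ^+ 2 / a j = 1.
Hypotheses (ik : a i < a k) (kl : a k < a l) (uk : u k != 0).

Let a_neq0 j : a j != 0. Proof. by rewrite gt_eqF. Qed.
(* If [v] vanishes on the eigenspace of [a k], the tangent vector [v - nrm v u] has Moser
   integral [u_k^2 N v]. *)
Let nrm v : R := \sum_j u j * v j / a j.
Let N v : R := nrm v ^+ 2 + res_form a k v v.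
Let supp (v : 'I_n -> R) := forall j, a j = a k -> v j = 0.
(* [w = a_k A^-1 u - u] *)
Let w j : R := u j * (a k - a j) / a j.
Let delta (i j : 'I_n) : R := (j == i)%:R.

Let nrm_comb p q v z : nrm (fun j => p * v j + q * z j) = p * nrm v + q * nrm z.
Proof. by rewrite /nrm !mulr_sumr -big_split; apply: eq_bigr => j _ /=; ring. Qed.

Let nrm_delta j : nrm (delta j) = u j / a j.
Proof.
rewrite /nrm (bigD1 j) //= big1 => [|r rj]; first by rewrite /delta eqxx mulr1 addr0.
by rewrite /delta (negbTE rj) mulr0 mul0r.
Qed.

Let res_delta j : a j != a k -> res_form a k (delta j) (delta j) = (a k - a j)^-1.
Proof.
move=> jk; rewrite /res_form (bigD1 j) //= big1 => [|r /andP[_ rj]].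
  by rewrite /delta eqxx addr0 !mul1r.
by rewrite /delta (negbTE rj) !mul0r.
Qed.

(** [w] represents the linear form [nrm] with respect to [res_form], so that both parts of [N] can
    be evaluated along [w]. *)
Let res_w v : supp v -> res_form a k w v = nrm v.
Proof.
move=> sv; rewrite /res_form /nrm [RHS](bigID (fun j => a j != a k)) /=.
rewrite [X in _ = _ + X]big1 ?addr0 => [|j]; last first.
  by rewrite negbK => /eqP /sv ->; rewrite mulr0 mul0r.
apply: eq_bigr => j ajk; rewrite /w; field.
by rewrite a_neq0 subr_eq0 eq_sym.
Qed.

Let supp_w : supp w.
Proof. by move=> j ajk; rewrite /w ajk subrr mulr0 mul0r. Qed.

Let nrm_w_gt : 0 < nrm w + 1.
Proof.
have -> : nrm w + 1 = a k * \sum_j (u j / a j) ^+ 2.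
  rewrite -u1 /nrm -big_split mulr_sumr; apply: eq_bigr => j _ /=; rewrite /w.
  by field; rewrite a_neq0.
rewrite mulr_gt0 // (bigD1 k) //= ltr_wpDr ?sumr_ge0 // => [j _|]; first exact: sqr_ge0.
by rewrite exprn_even_gt0 //= mulf_neq0 ?invr_eq0.
Qed.

Let supp_comb p q v z : supp v -> supp z -> supp (fun j => p * v j + q * z j).
Proof. by move=> sv sz j ajk; rewrite sv // sz // !mulr0 addr0. Qed.

Let supp_delta j : a j != a k -> supp (delta j).
Proof. by move=> jk r rk; rewrite /delta; case: eqP => // rj; rewrite -rj rk eqxx in jk. Qed.

Let N_delta_i : 0 < N (delta i).
Proof.
rewrite /N res_delta ?lt_eqF // ltr_wpDl ?sqr_ge0 // invr_gt0 subr_gt0 //.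
Qed.

(** If [w = 0], then [u_l = 0] and [delta l] works. Otherwise [N w = nrm w (nrm w + 1)] settles the
    case [nrm w <= 0]. If [nrm w > 0], adding a multiple of [w] to [delta l] makes [nrm] vanish, and
    [N] is then negative. *)
Let nonpos_direction : exists v, [/\ supp v, exists j, v j != 0 & N v <= 0].
Proof.
have lk : a l != a k by rewrite gt_eqF.
have dl : (a k - a l)^-1 < 0 by rewrite invr_lt0 subr_lt0.
have dl1 : delta l l != 0 by rewrite /delta eqxx oner_eq0.
have [/existsP[j wj]|/existsPn w0] := boolP [exists j, w j != 0]; last first.
  exists (delta l); split; [exact: supp_delta | by exists l |].
  rewrite /N nrm_delta res_delta //.
  have : w l == 0 by apply/negPn; exact: w0 l.
  rewrite /w !mulf_eq0 invr_eq0 (negbTE (a_neq0 l)) subr_eq0 [a k == _]eq_sym (negbTE lk) !orbF.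
  by move=> /eqP ->; rewrite mul0r expr0n add0r ltW.
have [S0|S0] := lerP (nrm w) 0.
  exists w; split; [exact: supp_w | by exists j |].
  by rewrite /N res_w //; have := nrm_w_gt; nra.
pose s := - (u l / a l / nrm w).
pose v r := 1 * delta l r + s * w r.
have sv : supp v by apply: supp_comb => //; exact: supp_delta.
have nv : nrm v = 0.
  by rewrite /v nrm_comb nrm_delta /s; field; rewrite a_neq0 gt_eqF.
have Nv : N v < 0.
  rewrite /N nv expr0n add0r /v res_form_comb res_delta // res_formC !res_w //; last exact: supp_delta.
  rewrite nrm_delta.
  have -> : 1 ^+ 2 * (a k - a l)^-1 + 2 * 1 * s * (u l / a l) + s ^+ 2 * nrm w =
    (a k - a l)^-1 - (u l / a l) ^+ 2 / nrm w.
    by rewrite /s; field; rewrite a_neq0 gt_eqF //= subr_eq0 eq_sym.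
  by rewrite ltr_wnDr // oppr_le0 divr_ge0 ?sqr_ge0 // ltW.
exists v; split; [exact: sv | | exact: ltW].
apply/existsP; rewrite -negb_forall; apply/negP => /forallP v0.
suff vE : v = fun=> 0.
  move: Nv; rewrite vE /N /nrm /res_form !big1 ?expr0n ?addr0 ?ltxx // => r _;
    by rewrite !mulr0 mul0r.
by apply/funext => r; apply/eqP; exact: v0 r.
Qed.

(** [N] is nonpositive at [z] and positive at [delta i], so the quadratic polynomial
    [N (z + s delta i)] in [s] has a real root. *)
Let null_direction : exists v, [/\ supp v, exists j, v j != 0 & N v = 0].
Proof.
have [z [sz [j zj] Nz]] := nonpos_direction.
have Ni := N_delta_i; have ik' : a i != a k by rewrite lt_eqF.
pose B := nrm z * nrm (delta i) + res_form a k z (delta i).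
have Nc s : N (fun r => 1 * z r + s * delta i r) = N z + 2 * s * B + s ^+ 2 * N (delta i).
  by rewrite /N nrm_comb res_form_comb /B; ring.
pose D := B ^+ 2 - N z * N (delta i).
have D0 : 0 <= D by rewrite subr_ge0 (le_trans _ (sqr_ge0 B)) // mulr_le0_ge0 // ltW.
pose s := (Num.sqrt D - B) / N (delta i).
have Ns : N (fun r => 1 * z r + s * delta i r) = 0.
  rewrite Nc; have := sqr_sqrtr D0; set r := Num.sqrt D => r2.
  have sE : s * N (delta i) = r - B by rewrite /s divfK // gt_eqF.
  apply: (mulfI (x := N (delta i))); first by rewrite gt_eqF.
  rewrite mulr0; transitivity (N z * N (delta i) + 2 * B * (s * N (delta i)) + (s * N (delta i)) ^+ 2).
    by ring.
  rewrite sE; transitivity (r ^+ 2 - D); last by rewrite r2 subrr.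
  by rewrite /D; ring.
exists (fun r => 1 * z r + s * delta i r); split => //.
  by apply: supp_comb => //; exact: supp_delta.
(* The vector found could vanish only if [z] were a multiple of [delta i]; then [N z <= 0] makes the
   factor, and with it [z], zero. *)
apply/existsP; rewrite -negb_forall; apply/negP => /forallP v0.
have zE : z = fun r => 0 * z r + (- s) * delta i r.
  apply/funext => r; have := v0 r; rewrite mul1r addr_eq0 => /eqP ->.
  by rewrite mul0r add0r mulNr.
have NzE : N z = s ^+ 2 * N (delta i).
  by rewrite {1}zE /N nrm_comb res_form_comb; ring.
have s0 : s == 0.
  rewrite -sqrf_eq0 eq_le sqr_ge0 andbT -(ler_pM2r Ni) mul0r -NzE //.
by move: zj; rewrite zE (eqP s0) oppr0 !mul0r addr0 eqxx.
Qed.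

Lemma moser_null_direction (T : R) : exists v : 'I_n -> R,
  [/\ \sum_j u j * v j / a j = 0, \sum_j v j ^+ 2 = T ^+ 2,
      forall j, a j = a k -> u k * v j = u j * v k &
      moser_integral a k u v = 0].
Proof.
have [v [sv [j vj] Nv]] := null_direction.
pose s := nrm v; pose z r := 1 * v r + (- s) * u r.
have zk : z k = - s * u k by rewrite /z sv // mulr0 add0r.
have nz : nrm z = 0.
  rewrite /z nrm_comb -/s mul1r; suff -> : nrm u = 1 by rewrite mulr1 subrr.
  by rewrite -u1; apply: eq_bigr => r _; rewrite expr2.
have az r : a r = a k -> u k * z r = u r * z k.
  by move=> rk; rewrite zk /z sv // ; ring.
have Fz : moser_integral a k u z = 0.
  rewrite /moser_integral /moser_p /moser_q zk /z res_form_comb res_formC res_form_combl.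
  move: Nv; rewrite /N -/s => Nv.
  transitivity (u k ^+ 2 * (s ^+ 2 + res_form a k v v)); last by rewrite Nv mulr0.
  by rewrite (res_formC a k v u); ring.
(* Since [z_k = - s u_k] with [u_k <> 0], the vanishing of [z] would give [s = 0] and then
   [z = v]. *)
have z0 : 0 < \sum_r z r ^+ 2.
  rewrite lt_neqAle sumr_ge0 ?andbT => [|r _]; last exact: sqr_ge0.
  rewrite eq_sym psumr_eq0 => [|r _]; last exact: sqr_ge0.
  apply/negP => /allP al.
  have zr r : z r = 0.
    by have := al r; rewrite mem_index_enum sqrf_eq0 => /(_ isT)/eqP.
  have := zr k; rewrite zk => /eqP; rewrite mulf_eq0 (negbTE uk) orbF oppr_eq0 => /eqP s0.
  by have := zr j; rewrite /z s0 oppr0 mul0r addr0 mul1r => /eqP; rewrite (negbTE vj).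
pose q := T / Num.sqrt (\sum_r z r ^+ 2).
have qz : \sum_r (q * z r) ^+ 2 = T ^+ 2.
  under eq_bigr do rewrite exprMn.
  rewrite -mulr_sumr /q expr_div_n sqr_sqrtr ?(ltW z0) // divfK // gt_eqF //.
exists (fun r => q * z r); split => //.
- by under eq_bigr do rewrite mulrCA -mulrA; rewrite -mulr_sumr -/(nrm z) nz mulr0.
- by move=> r rk; rewrite mulrCA az // mulrCA.
- by rewrite moser_integralZ Fz mulr0.
Qed.

End NullDirection.

(** * Monotone drift on a null level of a Moser integral *)

(** Self-focality in eigencoordinates, with velocities of norm [T] so that the return time is 1. *)
Definition refocuses (R : realType) (n : nat) (a : 'I_n -> R) (T : R) (u : 'I_n -> R) :=
  forall v : 'I_n -> R, \sum_j u j * v j / a j = 0 -> \sum_j v j ^+ 2 = T ^+ 2 ->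
  exists x y lam, [/\ ellipsoid_flow a T x y lam,
    forall j, x j 0 = u j, forall j, y j 0 = v j & forall j, x j 1 = u j].

Section Drift.
Variables (R : realType) (n : nat) (a : 'I_n -> R) (amin amax T : R).
Hypotheses (amin_gt0 : 0 < amin) (a_bd : forall j, amin <= a j <= amax).
Hypotheses (amax_gt0 : 0 < amax) (T_gt0 : 0 < T).
Variables (u : 'I_n -> R) (k : 'I_n).
Hypothesis uk : u k != 0.

Let a_gt0 j : 0 < a j.
Proof. by have /andP[h _] := a_bd j; apply: lt_le_trans h. Qed.

Let admissible (v : 'I_n -> R) :=
  [/\ \sum_j u j * v j / a j = 0, \sum_j v j ^+ 2 = T ^+ 2,
      forall j, a j = a k -> u k * v j = u j * v k &
      moser_integral a k u v = 0].

(** Coordinate speeds are at most [T], so [|x_k|] is at least [|u_k| / 2] up to time [h]; the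
    minimum with 1 keeps [h] within one loop. [delta] is [h] times the resulting lower bound for
    [lam e0 / a_k^2]. *)
Let h := Num.min 1 (`|u k| / (2 * T)).
Let delta := T ^+ 2 * amin / amax / a k ^+ 2 * (`|u k| / 2) ^+ 2 * h.

Let h_gt0 : 0 < h.
Proof. by rewrite /h lt_min ltr01 divr_gt0 ?normr_gt0 ?mulr_gt0. Qed.

Lemma drift_gt0 : 0 < delta.
Proof.
by rewrite /delta !mulr_gt0 ?invr_gt0 ?exprn_gt0 ?divr_gt0 ?normr_gt0.
Qed.

(** At [u] the quotient [kap] equals [p / u_k]. Its derivative [- lam e0 / a_k^2] is never positive,
    and up to time [h] it is bounded away from zero. Admissibility is preserved, so that the step
    can be repeated. *)
Lemma drift_step x y lam v : ellipsoid_flow a T x y lam ->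
  (forall j, x j 0 = u j) -> (forall j, y j 0 = v j) -> (forall j, x j 1 = u j) ->
  admissible v ->
  admissible (fun j => y j 1) /\
  moser_p a k u (fun j => y j 1) / u k <= moser_p a k u v / u k - delta.
Proof.
move=> flow x0 y0 x1 [vtan vnorm vali vF].
have [dx dy _ ynorm _] := flow.
have tangent := flow_tangent amin_gt0 a_bd flow.
have aligned j t : a j = a k -> x k t * y j t = x j t * y k t.
  move=> jk; have := flow_wronskian flow (esym jk) t.
  by rewrite !x0 !y0 vali // subrr => /eqP; rewrite subr_eq0 => /eqP.
have xE0 : (fun j => x j 0) = u by apply/funext.
have xE1 : (fun j => x j 1) = u by apply/funext.
have yE0 : (fun j => y j 0) = v by apply/funext.
have Fc t : moser_integral a k (fun j => x j t) (fun j => y j t) = 0.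
  by rewrite (moser_integral_const flow a_gt0 aligned tangent t 0) xE0 yE0.
split.
  split.
  - by have := tangent 1; under eq_bigr do rewrite x1.
  - by rewrite ynorm.
  - by move=> j jk; have := aligned j 1 jk; rewrite !x1.
  - by have := Fc 1; rewrite xE1.
pose e0 t := \sum_(j | a j == a k) x j t ^+ 2.
pose p t := moser_p a k (fun j => x j t) (fun j => y j t).
pose q t := moser_q a k (fun j => x j t) (fun j => y j t).
pose r t := x k t ^+ 2 + y k t ^+ 2.
(* On the null level [p = kap x_k] and [q = kap y_k], so that [kap] stays smooth where
   [x_k] vanishes. *)
pose kap t := (p t * x k t + q t * y k t) / r t.
have lamn := flow_lam_norm amin_gt0 a_bd flow T_gt0 amax_gt0.
have r_gt0 (t : R) : 0 <= t -> 0 < r t.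
  by apply: (hill_energy_gt0 (a_gt0 k) lamn (dx k) (dy k)); rewrite x0.
have pq t : y k t * p t = x k t * q t.
  by apply/eqP; rewrite -subr_eq0; apply/eqP; exact: Fc t.
have pE (t : R) : 0 <= t -> p t = kap t * x k t.
  move=> /r_gt0 rt; apply: (mulIf (x := r t)); first by rewrite gt_eqF.
  rewrite mulrAC /kap divfK ?gt_eqF // /r; apply/eqP; rewrite -subr_eq0; apply/eqP.
  transitivity (y k t * (y k t * p t - x k t * q t)); first by ring.
  by rewrite pq subrr mulr0.
have qE (t : R) : 0 <= t -> q t = kap t * y k t.
  move=> /r_gt0 rt; apply: (mulIf (x := r t)); first by rewrite gt_eqF.
  rewrite mulrAC /kap divfK ?gt_eqF // /r; apply/eqP; rewrite -subr_eq0; apply/eqP.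
  transitivity (x k t * (x k t * q t - y k t * p t)); first by ring.
  by rewrite pq subrr mulr0.
have dkap (t : R) : 0 <= t -> is_derive t 1 kap (- (lam t / a k ^+ 2 * e0 t)).
  move=> t0; have rt := r_gt0 t t0; rewrite /kap.
  have dp : is_derive t 1 p (q t - lam t / a k ^+ 2 * e0 t * x k t).
    exact: (moser_p_derive k flow a_gt0).
  have dq : is_derive t 1 q (- (lam t / a k) * p t - lam t / a k ^+ 2 * e0 t * y k t).
    exact: (moser_q_derive flow a_gt0 aligned tangent).
  have rn : r t != 0 by rewrite gt_eqF.
  have dr : is_derive t 1 r (2 * x k t * y k t * (1 - lam t / a k)).
    by rewrite /r; have := dx k; have := dy k => dyk dxk; der; field; rewrite gt_eqF.
  have := dx k; have := dy k => dyk dxk.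
  clear dx dy; der; rewrite (pE t t0) (qE t t0); move: (kap t) => K.
  move: rn; rewrite /r => rn; field; rewrite rn /= gt_eqF //.
have lam_gt0 := flow_lam_gt0 amin_gt0 a_bd flow T_gt0 amax_gt0.
have e0_ge t : x k t ^+ 2 <= e0 t.
  by rewrite /e0 (bigD1 k) //= lerDl sumr_ge0 // => j _; rewrite sqr_ge0.
have dkap_le0 (t : R) : - (lam t / a k ^+ 2 * e0 t) <= 0.
  rewrite oppr_le0 !mulr_ge0 ?(ltW (lam_gt0 t)) ?invr_ge0 ?sqr_ge0 //.
  by apply: le_trans (e0_ge t); rewrite sqr_ge0.
have h1 : h <= 1 by rewrite /h ge_min lexx.
have kap1 : kap 1 <= kap h.
  apply: (der_le0_le (df := fun t => - (lam t / a k ^+ 2 * e0 t)) h1) => t // /andP[ht _].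
  by apply: dkap; apply: le_trans ht; rewrite ltW.
have kap0 : kap h <= kap 0 - delta.
  have dk (t : R) : 0 <= t <= h -> is_derive t 1 kap (- (lam t / a k ^+ 2 * e0 t)).
    by move=> /andP[t0 _]; exact: dkap.
  have [s [/andP[s0 sh] E]] := der_MVT (ltW h_gt0) dk.
  rewrite -lerBlDl E subr0 mulNr lerN2 /delta ler_wpM2r ?(ltW h_gt0) //.
  have xs : `|u k| / 2 <= `|x k s|.
    have [t [_ Et]] := der_MVT s0 (fun t _ => dx k t).
    have : `|u k - x k s| <= `|u k| / 2.
      rewrite -normrN opprB -(x0 k) Et subr0 normrM (ger0_norm s0) x0.
      apply: (@le_trans _ _ (T * s)); first by rewrite ler_wpM2r // (flow_speed_le flow T_gt0).
      have : h <= `|u k| / (2 * T) by rewrite /h ge_min lexx orbT.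
      move=> /(le_trans sh); rewrite invfM mulrA ler_pdivlMr // mulrC //.
    move=> d; have := ler_normD (u k - x k s) (x k s); rewrite subrK => d2.
    by lra.
  have sq : (`|u k| / 2) ^+ 2 <= e0 s.
    apply: le_trans (e0_ge s); rewrite -(real_normK (num_real (x k s))).
    by rewrite ler_pXn2r // nnegrE divr_ge0.
  have /andP[lam_ge _] := flow_lam_bd amin_gt0 a_bd flow amax_gt0 s.
  apply: ler_pM => //; last by rewrite ler_wpM2r ?invr_ge0 ?sqr_ge0.
    apply: divr_ge0; last exact: sqr_ge0.
    apply: divr_ge0; last exact: ltW.
    by apply: mulr_ge0; [exact: sqr_ge0|exact: ltW].
  exact: sqr_ge0.
have kapE (t : R) : 0 <= t -> x k t != 0 -> kap t = p t / x k t.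
  by move=> t0 xt; rewrite (pE t t0) mulfK.
have := le_trans kap1 kap0.
rewrite !kapE ?x0 ?x1 ?lexx ?ler01 // /p xE1 xE0 yE0 //.
Qed.

(** [moser_p] is linear in the velocity, whose coordinates are at most [T] in absolute value. *)
Lemma moser_p_bound (v : 'I_n -> R) : \sum_j v j ^+ 2 = T ^+ 2 ->
  - ((`|1 + res_form a k u u| * T +
      (\sum_(j | a j != a k) `|u j / (a k - a j)| * T) * `|u k|) / `|u k|)
  <= moser_p a k u v / u k.
Proof.
move=> vn; have vj j : `|v j| <= T.
  rewrite -(ler_pXn2r (n := 2)) ?nnegrE ?(ltW T_gt0) // real_normK ?num_real //.
  by rewrite -vn (bigD1 j) //= lerDl sumr_ge0 // => i _; rewrite sqr_ge0.
rewrite lerNl; apply: le_trans (ler_norm _) _; rewrite normrN normrM normfV.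
rewrite ler_wpM2r ?invr_ge0 // /moser_p.
apply: le_trans (ler_normB _ _) _; rewrite !normrM lerD ?ler_wpM2l ?ler_wpM2r //.
apply: le_trans (ler_norm_sum _ _ _) _; apply: ler_sum => j _.
by rewrite mulrAC normrM ler_wpM2l.
Qed.

Lemma no_refocus_noncritical i l : \sum_j u j ^+ 2 / a j = 1 ->
  a i < a k -> a k < a l -> ~ refocuses a T u.
Proof.
move=> u1 ik kl foc.
have [v0 adm0] := moser_null_direction a_gt0 u1 ik kl uk T.
have iter m : exists v, admissible v /\
    moser_p a k u v / u k <= moser_p a k u v0 / u k - m%:R * delta.
  elim: m => [|m [v [adm le]]]; first by exists v0; rewrite mul0r subr0.
  have [vtan vnorm _ _] := adm.
  have [x [y [lam [flow x0 y0 x1]]]] := foc v vtan vnorm.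
  have [adm1 le1] := drift_step flow x0 y0 x1 adm.
  exists (fun j => y j 1); split => //; apply: le_trans le1 _.
  have -> : m.+1%:R * delta = m%:R * delta + delta.
    by rewrite -[m.+1]addn1 natrD mulrDl mul1r.
  by rewrite opprD addrA lerD2r.
set M := (`|1 + res_form a k u u| * T +
  (\sum_(j | a j != a k) `|u j / (a k - a j)| * T) * `|u k|) / `|u k|.
(* After [m.+1] loops the drift exceeds the distance from the initial value down to the lower bound
   [- M]. *)
pose m := Num.truncn ((moser_p a k u v0 / u k + M) / delta).
have [v [[_ vnorm _ _] le]] := iter m.+1.
have := le_trans (moser_p_bound vnorm) le; rewrite -/M.
have := truncnS_gt ((moser_p a k u v0 / u k + M) / delta); rewrite -/m.
rewrite ltr_pdivrMr ?drift_gt0 //; lra.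
Qed.

End Drift.

(** * Hyperbolicity of the middle ellipse *)

(* [A] and [B] are the quotients of successive polynomial divisions, in [v] and then in
   [S]. *)
Lemma shear_identity (R : comPzRingType) (C S b g s v : R) :
  v ^+ 2 = s ^+ 2 + b ^+ 2 * C ^+ 2 - g ^+ 2 * S ^+ 2 -> S ^+ 2 = 1 - C ^+ 2 ->
  let l := b * C - g * S in let m := - b * S - g * C in
  let e := C * S * (b ^+ 2 + g ^+ 2) in
  - ((s ^+ 2 - g ^+ 2) * (s ^+ 2 + b ^+ 2) * l * (v + s) ^+ 2)
  - e * m * (v + s) ^+ 2 * s ^+ 2 + e * l * b * g * (v + s) * s
  + l * v ^+ 2 * (v + s) ^+ 2 * s ^+ 2 + l * b * g * s * v * e
  + 2 * (m * b * g * v ^+ 2 * (v + s) * s) - b ^+ 2 * g ^+ 2 * v ^+ 2 * l = 0.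
Proof.
move=> v2 S2 l m e.
pose A := - S * g * s ^+ 2 * v ^+ 2 - 2 * S * g * s ^+ 3 * v - S * g * s ^+ 4 - S * g ^+ 3 * s
     ^+ 2 - 2 * S * b ^+ 2 * g * s * v - S * b ^+ 2 * g * s ^+ 2 + S ^+ 3 * g ^+ 3 * s ^+
     2 + C * b * s ^+ 2 * v ^+ 2 + 2 * C * b * s ^+ 3 * v + C * b * s ^+ 4 - 2 * C * b *
     g ^+ 2 * s * v - C * b * g ^+ 2 * s ^+ 2 - C * b ^+ 3 * s ^+ 2 + C * S ^+ 2 * b ^+ 3
     * s ^+ 2 + C ^+ 2 * S * g ^+ 3 * s ^+ 2 + C ^+ 3 * b ^+ 3 * s ^+ 2.
pose B := 2 * S * g ^+ 3 * s ^+ 3 * v + 2 * S * g ^+ 3 * s ^+ 4 + 2 * S * b ^+ 2 * g ^+ 3 * s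
     * v + S * b ^+ 2 * g ^+ 3 * s ^+ 2 - S ^+ 3 * g ^+ 5 * s ^+ 2 + 2 * C * b ^+ 3 * s
     ^+ 3 * v + 2 * C * b ^+ 3 * s ^+ 4 - 2 * C * b ^+ 3 * g ^+ 2 * s * v - C * b ^+ 3 *
     g ^+ 2 * s ^+ 2 - C * S ^+ 2 * b ^+ 3 * g ^+ 2 * s ^+ 2 + C ^+ 2 * S * b ^+ 2 * g ^+
     3 * s ^+ 2 + C ^+ 3 * b ^+ 5 * s ^+ 2.
transitivity (A * (v ^+ 2 - (s ^+ 2 + b ^+ 2 * C ^+ 2 - g ^+ 2 * S ^+ 2)) +
              B * (S ^+ 2 - (1 - C ^+ 2))).
  by rewrite /A /B /l /m /e; ring.
by rewrite v2 S2 !subrr !mulr0 addr0.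
Qed.

(** A lower bound for the exponential rate [(b g / s) w / (T / w + s)] along the ellipse: [T / w] is
    replaced by its upper bound [sqrt (s^2 + b^2)]. *)
Definition shear_rate (R : realType) (T s b g : R) : R :=
  b * g / s * (T / Num.sqrt (s ^+ 2 + b ^+ 2)) / (Num.sqrt (s ^+ 2 + b ^+ 2) + s).

Section Shear.
Variables (R : realType) (T s b g : R) (lam C S w : R -> R).
Hypotheses (T_gt0 : 0 < T) (s_gt0 : 0 < s) (b_gt0 : 0 < b) (g_gt0 : 0 < g).
Hypothesis gs : g < s.

(** In the application [s^2 = a_k], [alpha = amin] and [beta = amax]. The point [C P + S Q] runs
    along the ellipse with angular velocity [w], and [V] is its squared speed per unit angle. *)
Let alpha := s ^+ 2 - g ^+ 2.
Let beta := s ^+ 2 + b ^+ 2.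
Let V t := alpha * S t ^+ 2 + beta * C t ^+ 2.

Hypothesis dC : forall t : R, 0 <= t <= 1 -> is_derive t 1 C (- w t * S t).
Hypothesis dS : forall t : R, 0 <= t <= 1 -> is_derive t 1 S (w t * C t).
Hypothesis dw : forall t : R, 0 <= t <= 1 ->
  is_derive t 1 w (lam t * C t * S t * (alpha^-1 - beta^-1)).
Hypothesis circle : forall t, 0 <= t <= 1 -> C t ^+ 2 + S t ^+ 2 = 1.
Hypothesis speed : forall t, 0 <= t <= 1 -> w t ^+ 2 * V t = T ^+ 2.
Hypothesis w_gt0 : forall t, 0 <= t <= 1 -> 0 < w t.
Hypothesis lamE : forall t, 0 <= t <= 1 -> lam t = w t ^+ 2 * alpha * beta / V t.

Variables (lam' X Y : R -> R).
Hypothesis dX : forall t : R, is_derive t 1 X (Y t).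
Hypothesis dY : forall t : R, is_derive t 1 Y (- (lam' t / s ^+ 2) * X t).

(** [m] is the derivative of [l] in the angle. [h], in which [T / w] is the speed per unit angle, is
    the negative exponential rate per unit angle. *)
Let l t := b * C t - g * S t.
Let m t := - b * S t - g * C t.
Let h t := - (b * g / s) / (T / w t + s).
(* [U] is the Wronskian of [X] and the solution [l t * exp (\int h w)] of the Hill
   equation with [lam], without its exponential factor. *)
Let U t := Y t * l t - X t * w t * (m t + l t * h t).
Let d t := (lam t - lam' t) * X t * l t / s ^+ 2.

Let alpha_gt0 : 0 < alpha.
Proof. by rewrite subr_gt0 ltr_pXn2r // nnegrE ltW. Qed.

Let beta_gt0 : 0 < beta.
Proof. by rewrite addr_gt0 // exprn_gt0. Qed.

Let dU (t : R) : 0 <= t <= 1 -> is_derive t 1 U (- h t * w t * U t + d t).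
Proof.
move=> t01; have := dC t01; have := dS t01; have := dw t01 => hw hS hC.
have wt := w_gt0 t01; have wn : w t != 0 by rewrite gt_eqF.
have hC2 := circle t01; have hV := speed t01; have hl := lamE t01.
pose v := T / w t; have v_gt0 : 0 < v by rewrite divr_gt0.
have TE : T = v * w t by rewrite /v divfK.
have v2 : v ^+ 2 = V t.
  apply: (mulfI (x := w t ^+ 2)); first by rewrite expf_neq0.
  by rewrite hV TE; ring.
have vsn : T / w t + s != 0 by rewrite gt_eqF // addr_gt0.
have vsn' : v + s != 0 by [].
have hdX := dX t; have hdY := dY t.
have I := @shear_identity R (C t) (S t) b g s v.
have vE : v ^+ 2 = s ^+ 2 + b ^+ 2 * C t ^+ 2 - g ^+ 2 * S t ^+ 2.
  by rewrite v2 /V /alpha /beta; apply/eqP; rewrite -subr_eq0; apply/eqP;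
     transitivity (s ^+ 2 * (C t ^+ 2 + S t ^+ 2 - 1)); [ring | rewrite hC2 subrr mulr0].
have S2 : S t ^+ 2 = 1 - C t ^+ 2 by rewrite -hC2; ring.
have {}I := I vE S2; cbv zeta in I.
rewrite /U /l /m /h; clear dC dS dw circle speed lamE; der.
have Tw : T / w t = v by [].
clearbody v; rewrite !Tw /d hl -v2 {1}TE.
have aln : alpha != 0 by rewrite gt_eqF.
have ben : beta != 0 by rewrite gt_eqF.
have sn : s != 0 by rewrite gt_eqF.
have vn : v != 0 by rewrite gt_eqF.
apply/eqP; rewrite -subr_eq0; apply/eqP.
(* The difference of the two sides is [c] times the expression in [shear_identity]; [c] carries the
   denominators. *)
pose c := X t * w t ^+ 2 / (v ^+ 2 * (v + s) ^+ 2 * s ^+ 2).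
apply: etrans (mulr0 c); rewrite -[in RHS]I /c /l.
move: aln ben vsn' sn vn wn; rewrite /alpha /beta.
by move=> *; field; repeat (apply/andP; split).
Qed.

Let vm := Num.sqrt beta.
Let mu := shear_rate T s b g.

Let vm_gt0 : 0 < vm. Proof. by rewrite sqrtr_gt0. Qed.
Let mu_gt0 : 0 < mu.
Proof. by rewrite /mu /shear_rate divr_gt0 ?mulr_gt0 ?invr_gt0 ?addr_gt0. Qed.

Let mu_le t : 0 <= t <= 1 -> mu <= - h t * w t.
Proof.
move=> t01; have wt := w_gt0 t01.
have V_le : V t <= vm ^+ 2.
  rewrite sqr_sqrtr ?(ltW beta_gt0) // /V -[leRHS]mulr1 -(circle t01) mulrDr addrC lerD2l.
  by rewrite ler_wpM2r ?sqr_ge0 // /alpha /beta; have := sqr_ge0 g; have := sqr_ge0 b; lra.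
have v_le : T / w t <= vm.
  rewrite -(ler_pXn2r (n := 2)) ?nnegrE ?divr_ge0 ?(ltW T_gt0) ?(ltW wt) ?(ltW vm_gt0) //.
  apply: le_trans V_le; rewrite expr_div_n -(speed t01) mulrAC divff ?mul1r //.
  by rewrite expf_neq0 // gt_eqF.
rewrite /h !mulNr opprK mulrAC /mu /shear_rate -/beta -/vm.
have bg : 0 < b * g / s by rewrite divr_gt0 ?mulr_gt0.
have Tvm : 0 < T / vm by rewrite divr_gt0.
apply: ler_pM.
- by rewrite ltW // mulr_gt0.
- by rewrite invr_ge0 ltW // addr_gt0.
- by rewrite ler_wpM2l ?(ltW bg) // ler_pdivrMr // mulrC -ler_pdivrMr.
- by rewrite lef_pV2 ?posrE ?addr_gt0 ?divr_gt0 // lerD2r.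
Qed.

(** [U^2] takes the same value at both ends, since [X] vanishes and [|Y|], [C], [S] agree there. But
    [U' = - h w U + d] expands at rate at least [mu] with [|d| <= D], so [U^2] would have grown if
    it had started above [(D / mu)^2]. *)
Lemma shear_bound (e : R) : X 0 = 0 -> X 1 = 0 -> Y 1 ^+ 2 = Y 0 ^+ 2 -> C 1 = C 0 -> S 1 = S 0 ->
  (forall t, 0 <= t <= 1 -> `|(lam t - lam' t) * X t| <= e) ->
  Y 0 ^+ 2 * (b * C 0 - g * S 0) ^+ 2 <= (e * (b + g) / s ^+ 2 / shear_rate T s b g) ^+ 2.
Proof.
move=> X0 X1 Y1 C1 S1 le_e.
pose D := e * (b + g) / s ^+ 2.
have d_le t : 0 <= t <= 1 -> d t ^+ 2 <= D ^+ 2.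
  move=> t01; rewrite -real_normK ?num_real // ler_pXn2r ?nnegrE //; last first.
    rewrite /D !mulr_ge0 ?invr_ge0 ?sqr_ge0 ?addr_ge0 ?(ltW b_gt0) ?(ltW g_gt0) //.
    by apply: le_trans (le_e t t01).
  rewrite /d /D normrM (ger0_norm (x := (s ^+ 2)^-1)) ?invr_ge0 ?sqr_ge0 //.
  rewrite ler_wpM2r ?invr_ge0 ?sqr_ge0 // normrM ler_pM ?le_e //.
  have le1 r q : r ^+ 2 + q ^+ 2 = 1 -> `|r| <= 1 :> R.
    move=> E; rewrite -(ler_pXn2r (n := 2)) ?nnegrE // real_normK ?num_real //.
    by rewrite expr1n -E lerDl sqr_ge0.
  apply: le_trans (ler_normB _ _) _; rewrite !normrM (gtr0_norm b_gt0) (gtr0_norm g_gt0).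
  have c1 := le1 _ _ (circle t01).
  have s1 : `|S t| <= 1 by apply: (le1 _ (C t)); rewrite addrC circle.
  by apply: lerD; rewrite ler_piMr ?(ltW b_gt0) ?(ltW g_gt0).
pose c := (D / mu) ^+ 2.
have dz (t : R) : 0 <= t <= 1 -> is_derive t 1 (fun t => c - U t ^+ 2)
    (- (2 * U t * (- h t * w t * U t + d t))).
  by move=> /dU hU; der; ring.
have := gronwall (K := mu) (@ler01 R) dz.
have U0 : U 0 = Y 0 * (b * C 0 - g * S 0) by rewrite /U X0 !mul0r subr0.
have U1 : U 1 ^+ 2 = U 0 ^+ 2 by rewrite U0 /U X1 !mul0r subr0 !exprMn Y1 /l C1 S1.
rewrite U1 mulr1 => H; rewrite -exprMn -U0 -/mu -/D -/c.
have {}H : c - U 0 ^+ 2 <= (c - U 0 ^+ 2) * expR mu.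
  apply: H => t t01; have ml := mu_le t01; have dl := d_le t t01.
  have cE : mu ^+ 2 * c = D ^+ 2 by rewrite /c -exprMn [mu * _]mulrC divfK // gt_eqF.
  have : mu * (mu * (c - U t ^+ 2) + 2 * U t * (- h t * w t * U t + d t)) >= 0.
    (* The hypothesis of Gronwall's inequality for [c - U^2], multiplied by [mu], becomes a sum of
       nonnegative terms. *)
    have -> : mu * (mu * (c - U t ^+ 2) + 2 * U t * (- h t * w t * U t + d t)) =
      (D ^+ 2 - d t ^+ 2) + (mu * U t + d t) ^+ 2 + 2 * mu * (- h t * w t - mu) * U t ^+ 2.
      by rewrite -cE; ring.
    apply: addr_ge0; last first.
      apply: mulr_ge0; last exact: sqr_ge0.
      by rewrite mulr_ge0 ?subr_ge0 // mulr_ge0 // ltW.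
    by rewrite addr_ge0 ?sqr_ge0 ?subr_ge0.
  by rewrite pmulr_rge0 //; lra.
(* An inequality [z <= z * expR mu] with [mu > 0] forces [z >= 0]. *)
rewrite -subr_ge0; rewrite -subr_ge0 -{2}[c - _]mulr1 -mulrBr pmulr_lge0 // in H.
by rewrite subr_gt0 expR_gt1.
Qed.

End Shear.

(** * Dependence on initial conditions *)

Section Dependence.
Variables (R : realType) (n : nat) (a : 'I_n -> R) (amin amax T : R).
Hypotheses (amin_gt0 : 0 < amin) (a_bd : forall j, amin <= a j <= amax).
Hypotheses (amax_gt0 : 0 < amax) (T_gt0 : 0 < T).

Let a_gt0 j : 0 < a j.
Proof. by have /andP[h _] := a_bd j; apply: lt_le_trans h. Qed.

(** [rho] bounds the coordinates and [lmax] bounds [lam]. [L1] is a Lipschitz constant of the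
    quotient [lam]: its two summands come from the numerator and the denominator, and [amax^2]
    bounds the inverse of the product of two denominators. [K] is the Gronwall rate of the squared
    phase-space distance. *)
Let rho := Num.sqrt amax.
Let lmax := T ^+ 2 * amax / amin.
Let L1 := (n%:R * (2 * T / amin) / amin + T ^+ 2 / amin * (n%:R * (2 * rho / amin ^+ 2)))
  * amax ^+ 2.
Let K := n%:R * (2 + 2 * (lmax + L1 * rho) / amin).

Let rho_ge0 : 0 <= rho. Proof. exact: sqrtr_ge0. Qed.
Let amin_ge0 : 0 <= amin := ltW amin_gt0.
Let T_ge0 : 0 <= T := ltW T_gt0.
Let amax_ge0 : 0 <= amax := ltW amax_gt0.

Let L1_ge0 : 0 <= L1.
Proof.
rewrite /L1; apply: mulr_ge0; last exact: sqr_ge0.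
by apply: addr_ge0; rewrite ?(divr_ge0, mulr_ge0, sqr_ge0).
Qed.

Let lmax_ge0 : 0 <= lmax. Proof. by rewrite ?(divr_ge0, mulr_ge0, sqr_ge0). Qed.

Let ainv_le j : (a j)^-1 <= amin^-1.
Proof. by have /andP[h _] := a_bd j; rewrite lef_pV2 ?posrE. Qed.

Section TwoFlows.
Variables (x y x' y' : 'I_n -> R -> R) (lam lam' : R -> R).
Hypotheses (flow : ellipsoid_flow a T x y lam) (flow' : ellipsoid_flow a T x' y' lam').

Let E t := \sum_j ((x j t - x' j t) ^+ 2 + (y j t - y' j t) ^+ 2).
Let q t := Num.sqrt (E t).

Let E_ge0 t : 0 <= E t.
Proof. by apply: sumr_ge0 => j _; rewrite addr_ge0 ?sqr_ge0. Qed.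

Let q_ge0 t : 0 <= q t. Proof. exact: sqrtr_ge0. Qed.
Let q2 t : q t ^+ 2 = E t. Proof. exact: sqr_sqrtr. Qed.

Let dist_le j t : `|x j t - x' j t| <= q t /\ `|y j t - y' j t| <= q t.
Proof.
have h : (x j t - x' j t) ^+ 2 + (y j t - y' j t) ^+ 2 <= q t ^+ 2.
  rewrite q2 /E (bigD1 j) //= lerDl; apply: sumr_ge0 => i _.
  by rewrite addr_ge0 ?sqr_ge0.
by split; rewrite -(ler_pXn2r (n := 2)) ?nnegrE // real_normK ?num_real //;
  apply: le_trans h; rewrite ?lerDl ?lerDr sqr_ge0.
Qed.

Let x_le (z w : 'I_n -> R -> R) l j t : ellipsoid_flow a T z w l -> `|z j t| <= rho.
Proof.
move=> fl; rewrite -(ler_pXn2r (n := 2)) ?nnegrE // real_normK ?num_real //.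
by rewrite sqr_sqrtr //; apply: (flow_coord_le amin_gt0 a_bd fl).
Qed.

Let sum_le (F : 'I_n -> R) B : (forall j, `|F j| <= B) -> `|\sum_j F j| <= n%:R * B.
Proof.
move=> FB; apply: le_trans (ler_norm_sum _ _ _) _.
apply: le_trans (ler_sum _ (fun j _ => FB j)) _.
by rewrite sumr_const card_ord mulr_natl.
Qed.

Let lam_le t : `|lam t - lam' t| <= L1 * q t.
Proof.
have [_ _ _ _ lE] := flow; have [_ _ _ _ lE'] := flow'.
have [D1 D2] := andP (flow_den_bd amin_gt0 a_bd flow t).
have [D1' D2'] := andP (flow_den_bd amin_gt0 a_bd flow' t).
have lb' := flow_lam_norm amin_gt0 a_bd flow' T_gt0 amax_gt0 t.
have N'E := lE' t.
rewrite lE lE' in N'E lb' *.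
set N := \sum_j y j t ^+ 2 / a j; set N' := \sum_j y' j t ^+ 2 / a j in lb' N'E *.
set D := \sum_j x j t ^+ 2 / a j ^+ 2 in D1 D2 *.
set D' := \sum_j x' j t ^+ 2 / a j ^+ 2 in D1' D2' lb' N'E *.
have D_gt0 : 0 < D by apply: lt_le_trans D1; rewrite invr_gt0.
have D'_gt0 : 0 < D' by apply: lt_le_trans D1'; rewrite invr_gt0.
have NN : `|N - N'| <= n%:R * (2 * T / amin) * q t.
  rewrite -mulrA /N /N' -sumrB; apply: sum_le => j.
  have -> : y j t ^+ 2 / a j - y' j t ^+ 2 / a j =
    (y j t - y' j t) * (y j t + y' j t) / a j by ring.
  rewrite !normrM (gtr0_norm (x := (a j)^-1)) ?invr_gt0 // -mulrA mulrC.
  apply: ler_pM => //; [by rewrite divr_ge0 // ltW| |exact: (dist_le j t).2].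
  apply: ler_pM => //; first by rewrite invr_ge0 ltW.
  apply: le_trans (ler_normD _ _) _.
  have := flow_speed_le flow T_gt0 j t; have := flow_speed_le flow' T_gt0 j t; lra.
have DD : `|D - D'| <= n%:R * (2 * rho / amin ^+ 2) * q t.
  rewrite -mulrA /D /D' -sumrB; apply: sum_le => j.
  have -> : x j t ^+ 2 / a j ^+ 2 - x' j t ^+ 2 / a j ^+ 2 =
    (x j t - x' j t) * (x j t + x' j t) / a j ^+ 2 by ring.
  rewrite !normrM (gtr0_norm (x := (a j ^+ 2)^-1)) ?invr_gt0 ?exprn_gt0 // -mulrA mulrC.
  apply: ler_pM => //; [by rewrite divr_ge0 ?sqr_ge0| |exact: (dist_le j t).1].
  apply: ler_pM => //; first by rewrite invr_ge0 sqr_ge0.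
    apply: le_trans (ler_normD _ _) _.
    have := x_le j t flow; have := x_le j t flow'; lra.
  by rewrite -!exprVn ler_pXn2r // nnegrE invr_ge0 ltW.
have N'_le : `|N'| <= T ^+ 2 / amin.
  have [_ _ _ yn _] := flow'.
  rewrite ger0_norm; last first.
    by apply: sumr_ge0 => j _; rewrite divr_ge0 ?sqr_ge0 // ltW.
  rewrite -(yn t) mulr_suml; apply: ler_sum => j _.
  by rewrite ler_wpM2l ?sqr_ge0.
have -> : N / D - N' / D' = ((N - N') * D' - N' * (D - D')) * (D^-1 * D'^-1).
  by field; rewrite !gt_eqF.
rewrite normrM /L1 [leRHS]mulrAC; apply: ler_pM => //.
  apply: le_trans (ler_normB _ _) _; rewrite !normrM mulrDl.
  apply: lerD.
    by rewrite mulrAC; apply: ler_pM => //; rewrite gtr0_norm.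
  by rewrite -[leRHS]mulrA; apply: ler_pM.
have inv_le d : 0 < d -> amax^-1 <= d -> d^-1 <= amax.
  by move=> d0 h; rewrite -[amax]invrK lef_pV2 ?posrE ?invr_gt0.
rewrite normrM !gtr0_norm ?invr_gt0 // expr2; apply: ler_pM; rewrite ?invr_ge0 ?inv_le //.
  exact: ltW.
exact: ltW.
Qed.

Let dE t : R := \sum_j (2 * (x j t - x' j t) * (y j t - y' j t) +
  2 * (y j t - y' j t) * (- (lam t / a j) * x j t - (- (lam' t / a j) * x' j t))).

Let dEP (t : R) : is_derive t 1 E (dE t).
Proof.
have [dx dy _ _ _] := flow; have [dx' dy' _ _ _] := flow'.
rewrite /E /dE; der; apply: eq_bigr => j _; ring.
Qed.

Let dE_le t : dE t <= K * E t.
Proof.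
apply: le_trans (ler_norm _) _; rewrite -q2 /K -mulrA.
apply: sum_le => j; have [hx hy] := dist_le j t.
have lamb := flow_lam_norm amin_gt0 a_bd flow T_gt0 amax_gt0 t.
have xb := x_le j t flow'.
have acc : `|- (lam t / a j) * x j t - (- (lam' t / a j) * x' j t)|
    <= (lmax + L1 * rho) / amin * q t.
  have -> : - (lam t / a j) * x j t - (- (lam' t / a j) * x' j t) =
    - ((lam t * (x j t - x' j t) + (lam t - lam' t) * x' j t) / a j) by ring.
  rewrite normrN normrM (gtr0_norm (x := (a j)^-1)) ?invr_gt0 // mulrAC.
  apply: ler_pM => //; first by rewrite invr_ge0 ltW.
  apply: le_trans (ler_normD _ _) _; rewrite !normrM mulrDl; apply: lerD.
    exact: ler_pM.
  rewrite mulrAC; apply: ler_pM => //; exact: lam_le.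
apply: le_trans (ler_normD _ _) _.
have -> : (2 + 2 * (lmax + L1 * rho) / amin) * q t ^+ 2 =
  2 * q t * q t + 2 * q t * ((lmax + L1 * rho) / amin * q t) by ring.
by apply: lerD; rewrite !normrM (ger0_norm (x := 2)) // ler_pM // ?ler_pM ?mulr_ge0.
Qed.

Lemma flow_lam_close t : 0 <= t <= 1 -> (lam t - lam' t) ^+ 2 <=
  L1 ^+ 2 * expR K * \sum_j ((x j 0 - x' j 0) ^+ 2 + (y j 0 - y' j 0) ^+ 2).
Proof.
move=> /andP[t0 t1].
have Et := gronwall t0 (fun s _ => dEP s) (fun s _ => dE_le s).
have K0 : 0 <= K.
  rewrite /K mulr_ge0 // addr_ge0 // divr_ge0 // mulr_ge0 // addr_ge0 // mulr_ge0 //.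
rewrite -(real_normK (num_real (lam t - lam' t))).
apply: (@le_trans _ _ ((L1 * q t) ^+ 2)).
  by rewrite ler_pXn2r ?nnegrE ?(mulr_ge0 L1_ge0 (q_ge0 t)) // lam_le.
rewrite exprMn q2 -mulrA ler_wpM2l ?sqr_ge0 // mulrC; apply: le_trans Et _.
by rewrite ler_wpM2l ?E_ge0 // ler_expR ler_piMr.
Qed.

End TwoFlows.

(** Phase-space distance grows at most exponentially and [lam] is Lipschitz in it. [L] is fixed
    before the flows, hence stays the same while a perturbation shrinks. *)
Lemma flow_lam_lipschitz : exists2 L, 0 <= L &
  forall x y x' y' lam lam', ellipsoid_flow a T x y lam -> ellipsoid_flow a T x' y' lam' ->
  forall t, 0 <= t <= 1 -> (lam t - lam' t) ^+ 2 <=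
    L * \sum_j ((x j 0 - x' j 0) ^+ 2 + (y j 0 - y' j 0) ^+ 2).
Proof.
exists (L1 ^+ 2 * expR K); first by rewrite mulr_ge0 ?sqr_ge0 ?expR_ge0.
by move=> x y x' y' lam lam' fl fl' t; apply: (flow_lam_close fl fl').
Qed.

End Dependence.

(** * Points on the ellipse of extreme axes *)

(** [P] is a semi-axis of the ellipsoid along the projection of [u] to the eigenspace; if that
    projection is zero, the axis of index [i] serves with [c = 0]. *)
Lemma eigen_axis (R : realType) (n : nat) (a u : 'I_n -> R) (al : R) (i : 'I_n) :
  0 < al -> a i = al -> exists (P : 'I_n -> R) (c : R),
  [/\ forall j, a j != al -> P j = 0, \sum_j P j ^+ 2 = al &
      forall j, a j = al -> u j = P j * c].
Proof.
move=> al0 ai; pose N := \sum_(j | a j == al) u j ^+ 2.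
have N0 : 0 <= N by apply: sumr_ge0 => j _; exact: sqr_ge0.
have [NE|Nn] := eqVneq N 0.
  exists (fun j => if j == i then Num.sqrt al else 0), 0; split.
  - by move=> j aj; case: eqP => // ji; rewrite ji ai eqxx in aj.
  - rewrite (bigD1 i) //= eqxx sqr_sqrtr ?(ltW al0) // big1 ?addr0 // => j ji.
    by rewrite (negbTE ji) expr0n.
  - move=> j aj; rewrite mulr0; move/eqP: NE.
    rewrite psumr_eq0 => [/allP/(_ j)|r _]; last exact: sqr_ge0.
    by rewrite mem_index_enum aj eqxx /= sqrf_eq0 => /(_ isT)/eqP.
have Np : 0 < N by rewrite lt_neqAle eq_sym Nn.
pose r := Num.sqrt (al / N); have r2 : r ^+ 2 = al / N by rewrite sqr_sqrtr // divr_ge0 // ltW.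
have rn : r != 0 by rewrite gt_eqF // sqrtr_gt0 divr_gt0.
exists (fun j => if a j == al then r * u j else 0), r^-1; split.
- by move=> j /negbTE ->.
- rewrite (bigID (fun j => a j == al)) /= [X in _ + X]big1 ?addr0 => [|j /negbTE ->];
    last by rewrite expr0n.
  transitivity (r ^+ 2 * N); last by rewrite r2 divfK.
  by rewrite /N mulr_sumr; apply: eq_bigr => j ->; rewrite exprMn.
- by move=> j ->; rewrite eqxx mulrAC divff // mul1r.
Qed.

Section Extremal.
Variables (R : realType) (n : nat) (a : 'I_n -> R) (amin amax T : R).
Hypotheses (amin_gt0 : 0 < amin) (a_bd : forall j, amin <= a j <= amax).
Hypotheses (amin_max : amin < amax) (T_gt0 : 0 < T).
Variables (P Q : 'I_n -> R) (C0 S0 : R) (u : 'I_n -> R).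
Hypothesis Psupp : forall j, a j != amin -> P j = 0.
Hypothesis Qsupp : forall j, a j != amax -> Q j = 0.
Hypothesis P2 : \sum_j P j ^+ 2 = amin.
Hypothesis Q2 : \sum_j Q j ^+ 2 = amax.
Hypothesis uE : forall j, u j = P j * C0 + Q j * S0.
Hypothesis u1 : \sum_j u j ^+ 2 / a j = 1.

Let amax_gt0 : 0 < amax. Proof. exact: lt_trans amin_max. Qed.
Let a_gt0 j : 0 < a j.
Proof. by have /andP[h _] := a_bd j; apply: lt_le_trans h. Qed.

Let PQ j : P j * Q j = 0.
Proof.
have [aj|/Psupp ->] := eqVneq (a j) amin; last by rewrite mul0r.
by rewrite Qsupp ?mulr0 // aj lt_eqF.
Qed.

Let plane_sum r p q p' q' :
  \sum_j (P j * p + Q j * q) * (P j * p' + Q j * q') / a j ^+ r =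
  p * p' * (amin / amin ^+ r) + q * q' * (amax / amax ^+ r).
Proof.
rewrite -{1}P2 -{1}Q2 !mulr_suml !mulr_sumr -big_split; apply: eq_bigr => j _ /=.
have -> : (P j * p + Q j * q) * (P j * p' + Q j * q') =
  P j ^+ 2 * (p * p') + Q j ^+ 2 * (q * q') + P j * Q j * (p * q' + q * p') by ring.
rewrite PQ mul0r addr0 mulrDl; congr (_ + _).
  have [->|/Psupp ->] := eqVneq (a j) amin; first by rewrite mulrAC mulrC.
  by rewrite expr0n !mul0r mulr0.
have [->|/Qsupp ->] := eqVneq (a j) amax; first by rewrite mulrAC mulrC.
by rewrite expr0n !mul0r mulr0.
Qed.

Let plane_sum0 p q p' q' : \sum_j (P j * p + Q j * q) * (P j * p' + Q j * q') =
  amin * (p * p') + amax * (q * q').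
Proof.
have := plane_sum 0 p q p' q'; rewrite !expr0 !divr1 => E.
by rewrite mulrC [amax * _]mulrC -E; apply: eq_bigr => j _; rewrite expr0 divr1.
Qed.

Let plane_sum1 p q p' q' : \sum_j (P j * p + Q j * q) * (P j * p' + Q j * q') / a j =
  p * p' + q * q'.
Proof.
have := plane_sum 1 p q p' q'; rewrite !expr1 !divff ?gt_eqF // !mulr1 => <-.
by apply: eq_bigr => j _; rewrite expr1.
Qed.

Let plane_sum2 p q p' q' : \sum_j (P j * p + Q j * q) * (P j * p' + Q j * q') / a j ^+ 2 =
  p * p' / amin + q * q' / amax.
Proof. by rewrite plane_sum; congr (_ + _); field; rewrite gt_eqF. Qed.

Lemma extremal_circle : C0 ^+ 2 + S0 ^+ 2 = 1.
Proof.
rewrite -u1 !expr2 -plane_sum1; apply: eq_bigr => j _.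
by rewrite uE expr2.
Qed.

Variable k : 'I_n.
Hypotheses (min_k : amin < a k) (k_max : a k < amax).

Let k_off j : a j = a k -> P j = 0 /\ Q j = 0.
Proof. by move=> jk; split; [apply: Psupp; rewrite jk gt_eqF | apply: Qsupp; rewrite jk lt_eqF]. Qed.

Let uk j : a j = a k -> u j = 0.
Proof. by move=> /k_off[Pj Qj]; rewrite uE Pj Qj !mul0r addr0. Qed.

(** As [u_k = 0], this is the coefficient of [v_k^2] in the Moser integral at [u]; it vanishes only
    at the umbilic-like points. *)
Lemma extremal_res_form : 1 + res_form a k u u =
  a k * ((amax - a k) * C0 ^+ 2 - (a k - amin) * S0 ^+ 2) / ((a k - amin) * (amax - a k)).
Proof.
have n1 : a k - amin != 0 by rewrite subr_eq0 gt_eqF.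
have n2 : amax - a k != 0 by rewrite subr_eq0 gt_eqF.
have -> : res_form a k u u = C0 ^+ 2 * (amin / (a k - amin)) + S0 ^+ 2 * (amax / (a k - amax)).
  rewrite -{1}P2 -{1}Q2 !mulr_suml !mulr_sumr -big_split /res_form /=.
  rewrite [RHS](bigID (fun j => a j != a k)) /= [X in _ = _ + X]big1 ?addr0 => [|j].
    apply: eq_bigr => j jk; rewrite uE.
    have -> : (P j * C0 + Q j * S0) * (P j * C0 + Q j * S0) =
      C0 ^+ 2 * P j ^+ 2 + S0 ^+ 2 * Q j ^+ 2 + 2 * (P j * Q j) * C0 * S0 by ring.
    rewrite PQ mulr0 !mul0r addr0 mulrDl; congr (_ + _).
      by have [E|/Psupp E] := eqVneq (a j) amin; rewrite E; ring.
    by have [E|/Qsupp E] := eqVneq (a j) amax; rewrite E; ring.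
  rewrite negbK => /eqP /k_off[-> ->].
  by rewrite expr0n !mul0r !mulr0 addr0.
have n3 : a k - amax != 0 by rewrite subr_eq0 lt_eqF.
apply/eqP; rewrite -subr_eq0; apply/eqP.
transitivity (1 - (C0 ^+ 2 + S0 ^+ 2)); last by rewrite extremal_circle subrr.
by field; rewrite n1 n2 n3.
Qed.

(** * The geodesic in the plane of two extreme axes *)

Section PlaneGeodesic.
Variables (x y : 'I_n -> R -> R) (lam : R -> R).
Hypothesis flow : ellipsoid_flow a T x y lam.
(** The initial angular velocity that gives speed [T]. *)
Let w0 := T / Num.sqrt (amin * S0 ^+ 2 + amax * C0 ^+ 2).
Hypothesis x0 : forall j, x j 0 = u j.
Hypothesis y0 : forall j, y j 0 = P j * (- w0 * S0) + Q j * (w0 * C0).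
Hypothesis x1 : forall j, x j 1 = u j.

Let C t := (\sum_j P j * x j t) / amin.
Let S t := (\sum_j Q j * x j t) / amax.
Let C1 t := (\sum_j P j * y j t) / amin.
Let S1 t := (\sum_j Q j * y j t) / amax.
Let w t := C t * S1 t - S t * C1 t.

Let dC (t : R) : is_derive t 1 C (C1 t).
Proof.
have [dx _ _ _ _] := flow; rewrite /C /C1; der.
by rewrite mulr0 addr0; congr (_ / _); apply: eq_bigr => j _; ring.
Qed.

Let dS (t : R) : is_derive t 1 S (S1 t).
Proof.
have [dx _ _ _ _] := flow; rewrite /S /S1; der.
by rewrite mulr0 addr0; congr (_ / _); apply: eq_bigr => j _; ring.
Qed.

Let dC1 (t : R) : is_derive t 1 C1 (- (lam t / amin) * C t).
Proof.
have [_ dy _ _ _] := flow; rewrite /C /C1; der.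
rewrite mulr0 addr0 mulrA; congr (_ / _); rewrite mulr_sumr; apply: eq_bigr => j _.
by have [E|/Psupp E] := eqVneq (a j) amin; rewrite E; ring.
Qed.

Let dS1 (t : R) : is_derive t 1 S1 (- (lam t / amax) * S t).
Proof.
have [_ dy _ _ _] := flow; rewrite /S /S1; der.
rewrite mulr0 addr0 mulrA; congr (_ / _); rewrite mulr_sumr; apply: eq_bigr => j _.
by have [E|/Qsupp E] := eqVneq (a j) amax; rewrite E; ring.
Qed.

Let coordP p q : (\sum_j P j * (P j * p + Q j * q)) / amin = p.
Proof.
have := plane_sum0 1 0 p q; rewrite mul1r mul0r mulr0 addr0 => E.
rewrite -[RHS](mulKf (x := amin)) ?gt_eqF // mulrC -E; congr (_ * _).
by apply: eq_bigr => j _; rewrite mulr1 mulr0 addr0.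
Qed.

Let coordQ p q : (\sum_j Q j * (P j * p + Q j * q)) / amax = q.
Proof.
have := plane_sum0 0 1 p q; rewrite mul1r mul0r mulr0 add0r => E.
rewrite -[RHS](mulKf (x := amax)) ?gt_eqF // mulrC -E; congr (_ * _).
by apply: eq_bigr => j _; rewrite mulr1 mulr0 add0r.
Qed.

Let C_0 : C 0 = C0.
Proof. by rewrite /C -[RHS](coordP _ S0); congr (_ / _); apply: eq_bigr => j _; rewrite x0 uE. Qed.
Let S_0 : S 0 = S0.
Proof. by rewrite /S -[RHS](coordQ C0); congr (_ / _); apply: eq_bigr => j _; rewrite x0 uE. Qed.
Let C_1 : C 1 = C 0.
Proof. by rewrite /C; congr (_ / _); apply: eq_bigr => j _; rewrite x0 x1. Qed.
Let S_1 : S 1 = S 0.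
Proof. by rewrite /S; congr (_ / _); apply: eq_bigr => j _; rewrite x0 x1. Qed.
Let C1_0 : C1 0 = - w0 * S0.
Proof.
by rewrite /C1 -[RHS](coordP _ (w0 * C0)); congr (_ / _); apply: eq_bigr => j _; rewrite y0.
Qed.
Let S1_0 : S1 0 = w0 * C0.
Proof.
by rewrite /S1 -[RHS](coordQ (- w0 * S0)); congr (_ / _); apply: eq_bigr => j _; rewrite y0.
Qed.

(** Each coordinate of the deviation from the plane solves a Hill equation with zero initial data:
    [P_j] and [Q_j] vanish unless [a_j] is the matching extreme eigenvalue. *)
Let in_plane j t : 0 <= t -> x j t = P j * C t + Q j * S t /\ y j t = P j * C1 t + Q j * S1 t.
Proof.
move=> t0; have [dx dy _ _ _] := flow.
pose X t := x j t - (P j * C t + Q j * S t).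
pose Y t := y j t - (P j * C1 t + Q j * S1 t).
have dX (r : R) : is_derive r 1 X (Y r).
  by rewrite /X /Y; der; ring.
have dY (r : R) : is_derive r 1 Y (- (lam r / a j) * X r).
  rewrite /X /Y; der.
  have -> : P j * (- (lam r / amin) * C r) = P j * (- (lam r / a j) * C r).
    by have [->//|/Psupp ->] := eqVneq (a j) amin; rewrite !mul0r.
  have -> : Q j * (- (lam r / amax) * S r) = Q j * (- (lam r / a j) * S r).
    by have [->//|/Qsupp ->] := eqVneq (a j) amax; rewrite !mul0r.
  ring.
have lamn := flow_lam_norm amin_gt0 a_bd flow T_gt0 amax_gt0.
have X0 : X 0 = 0 by rewrite /X x0 uE C_0 S_0 subrr.
have Y0 : Y 0 = 0 by rewrite /Y y0 C1_0 S1_0 subrr.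
have [/eqP Xt /eqP Yt] := hill_unique (a_gt0 j) lamn dX dY X0 Y0 t0.
by split; apply/eqP; rewrite -subr_eq0.
Qed.

Let circle t : 0 <= t -> C t ^+ 2 + S t ^+ 2 = 1.
Proof.
move=> t0; have [_ _ q1 _ _] := flow; rewrite -(q1 t) !expr2 -plane_sum1.
by apply: eq_bigr => j _; rewrite (in_plane j t0).1 expr2.
Qed.

Let tangent t : 0 <= t -> C t * C1 t + S t * S1 t = 0.
Proof.
move=> t0; rewrite -(flow_tangent amin_gt0 a_bd flow t) -plane_sum1.
by apply: eq_bigr => j _; have [<- <-] := in_plane j t0.
Qed.

Let C1E t : 0 <= t -> C1 t = - w t * S t.
Proof.
move=> t0; apply/eqP; rewrite -subr_eq0; apply/eqP.
transitivity (C1 t * (1 - (C t ^+ 2 + S t ^+ 2)) + C t * (C t * C1 t + S t * S1 t)).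
  by rewrite /w; ring.
by rewrite circle // tangent // subrr !mulr0 addr0.
Qed.

Let S1E t : 0 <= t -> S1 t = w t * C t.
Proof.
move=> t0; apply/eqP; rewrite -subr_eq0; apply/eqP.
transitivity (S1 t * (1 - (C t ^+ 2 + S t ^+ 2)) + S t * (C t * C1 t + S t * S1 t)).
  by rewrite /w; ring.
by rewrite circle // tangent // subrr !mulr0 addr0.
Qed.

Let speed t : 0 <= t -> w t ^+ 2 * (amin * S t ^+ 2 + amax * C t ^+ 2) = T ^+ 2.
Proof.
move=> t0; have [_ _ _ yn _] := flow; rewrite -(yn t).
have -> : \sum_j y j t ^+ 2 = amin * (C1 t * C1 t) + amax * (S1 t * S1 t).
  rewrite -plane_sum0; apply: eq_bigr => j _.
  by rewrite (in_plane j t0).2 expr2.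
by rewrite C1E // S1E //; ring.
Qed.

Let lamE t : 0 <= t -> lam t = w t ^+ 2 * amin * amax / (amin * S t ^+ 2 + amax * C t ^+ 2).
Proof.
move=> t0; have [_ _ _ _ ->] := flow.
have -> : \sum_j y j t ^+ 2 / a j = C1 t * C1 t + S1 t * S1 t.
  by rewrite -plane_sum1; apply: eq_bigr => j _; rewrite (in_plane j t0).2 expr2.
have -> : \sum_j x j t ^+ 2 / a j ^+ 2 = C t * C t / amin + S t * S t / amax.
  by rewrite -plane_sum2; apply: eq_bigr => j _; rewrite (in_plane j t0).1 expr2.
have -> : C1 t * C1 t + S1 t * S1 t = w t ^+ 2.
  rewrite C1E // S1E //; transitivity (w t ^+ 2 * (C t ^+ 2 + S t ^+ 2)); first by ring.
  by rewrite circle // mulr1.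
have V0 : amin * S t ^+ 2 + amax * C t ^+ 2 != 0.
  apply/eqP => V0; have := speed t0; rewrite V0 mulr0 => /esym/eqP.
  by rewrite sqrf_eq0 gt_eqF.
have -> : C t * C t / amin + S t * S t / amax =
    (amin * S t ^+ 2 + amax * C t ^+ 2) / (amin * amax).
  by field; rewrite !gt_eqF.
by field; rewrite V0 !gt_eqF.
Qed.

Let V0_gt0 : 0 < amin * S0 ^+ 2 + amax * C0 ^+ 2.
Proof.
apply: (@lt_le_trans _ _ (amin * (C0 ^+ 2 + S0 ^+ 2))).
  by rewrite extremal_circle mulr1.
by rewrite mulrDr addrC lerD2l ler_wpM2r ?sqr_ge0 // ltW.
Qed.

(** By [speed] the angular velocity never vanishes, so it keeps its initial sign. *)
Let w_gt0 t : 0 <= t -> 0 < w t.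
Proof.
move=> t0; apply: continuous_neq0_gt0 => //.
- apply: (@der_continuous _ _ (fun t => C1 t * S1 t + C t * (- (lam t / amax) * S t) -
    (S1 t * C1 t + S t * (- (lam t / amin) * C t)))) => r.
  by rewrite /w; der; ring.
- move=> r /andP[r0 _]; apply/eqP => wr; have := speed r0.
  by rewrite wr expr0n mul0r => /esym/eqP; rewrite sqrf_eq0 gt_eqF.
rewrite /w C_0 S_0 C1_0 S1_0.
have -> : C0 * (w0 * C0) - S0 * (- w0 * S0) = w0 * (C0 ^+ 2 + S0 ^+ 2) by ring.
by rewrite extremal_circle mulr1 divr_gt0 // sqrtr_gt0.
Qed.

Let s := Num.sqrt (a k).
Let b := Num.sqrt (amax - a k).
Let g := Num.sqrt (a k - amin).

Let s2 : s ^+ 2 = a k. Proof. by rewrite sqr_sqrtr // ltW. Qed.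
Let b2 : b ^+ 2 = amax - a k. Proof. by rewrite sqr_sqrtr // subr_ge0 ltW. Qed.
Let g2 : g ^+ 2 = a k - amin. Proof. by rewrite sqr_sqrtr // subr_ge0 ltW. Qed.

Lemma plane_shear_bound X Y lam' e :
  (forall t : R, is_derive t 1 X (Y t)) ->
  (forall t : R, is_derive t 1 Y (- (lam' t / a k) * X t)) ->
  X 0 = 0 -> X 1 = 0 -> Y 1 ^+ 2 = Y 0 ^+ 2 ->
  (forall t, 0 <= t <= 1 -> `|(lam t - lam' t) * X t| <= e) ->
  Y 0 ^+ 2 * (b * C0 - g * S0) ^+ 2 <= (e * (b + g) / a k / shear_rate T s b g) ^+ 2.
Proof.
move=> dX dY X0 X1 Y1 le_e.
have al : s ^+ 2 - g ^+ 2 = amin by rewrite s2 g2; ring.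
have be : s ^+ 2 + b ^+ 2 = amax by rewrite s2 b2; ring.
rewrite -C_0 -S_0 -s2.
apply: (@shear_bound R T s b g lam C S w _ _ _ _ _ _ _ _ _ _ _ _ lam' X Y) => //.
- by rewrite sqrtr_gt0.
- by rewrite sqrtr_gt0 subr_gt0.
- by rewrite sqrtr_gt0 subr_gt0.
- by rewrite ltr_sqrt // gtrBl.
- by move=> t /andP[t0 _]; rewrite -C1E //.
- by move=> t /andP[t0 _]; rewrite -S1E //.
- by move=> t /andP[t0 _]; rewrite al be /w; der; ring.
- by move=> t /andP[t0 _]; exact: circle.
- by move=> t /andP[t0 _]; rewrite al be speed.
- by move=> t /andP[t0 _]; exact: w_gt0.
- by move=> t /andP[t0 _]; rewrite al be lamE.
- by rewrite s2.
Qed.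

End PlaneGeodesic.

(** The plane geodesic with velocity [tau] is compared with one tilted towards [k], with
    [v_k = sg T] and [sg^2 = q]. Both [lam - lam'] and [x'_k] are of order [sg], so
    [plane_shear_bound] reads [q B <= (q M)^2]. Off the umbilic-like points [B > 0], which is
    impossible for small [q]. *)
Lemma refocus_focal : refocuses a T u ->
  (amax - a k) * C0 ^+ 2 = (a k - amin) * S0 ^+ 2.
Proof.
move=> foc; apply/eqP; apply/negPn/negP => nfocal.
pose b := Num.sqrt (amax - a k); pose g := Num.sqrt (a k - amin).
pose l0 := b * C0 - g * S0.
have l0n : l0 != 0.
  apply: contra nfocal => /eqP l0E; rewrite -subr_eq0.
  have -> : (amax - a k) * C0 ^+ 2 - (a k - amin) * S0 ^+ 2 = l0 * (b * C0 + g * S0).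
    rewrite -[amax - a k]sqr_sqrtr ?subr_ge0 ?(ltW k_max) // -/b.
    by rewrite -[a k - amin]sqr_sqrtr ?subr_ge0 ?(ltW min_k) // -/g /l0; ring.
  by rewrite l0E mul0r.
have resn : 1 + res_form a k u u != 0.
  rewrite extremal_res_form !mulf_eq0 invr_eq0 mulf_eq0 !subr_eq0.
  by rewrite (negbTE nfocal) !gt_eqF.
pose w0 := T / Num.sqrt (amin * S0 ^+ 2 + amax * C0 ^+ 2).
pose tau j := P j * (- w0 * S0) + Q j * (w0 * C0).
have tau_tan : \sum_j u j * tau j / a j = 0.
  by under eq_bigr do rewrite uE /tau; rewrite plane_sum1; ring.
have V0_gt0 : 0 < amin * S0 ^+ 2 + amax * C0 ^+ 2.
  apply: (@lt_le_trans _ _ (amin * (C0 ^+ 2 + S0 ^+ 2))).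
    by rewrite extremal_circle mulr1.
  by rewrite mulrDr addrC lerD2l ler_wpM2r ?sqr_ge0 // ltW.
have tau_norm : \sum_j tau j ^+ 2 = T ^+ 2.
  have -> : \sum_j tau j ^+ 2 = amin * ((- w0 * S0) * (- w0 * S0)) + amax * ((w0 * C0) * (w0 * C0)).
    by rewrite -plane_sum0; apply: eq_bigr => j _; rewrite expr2.
  transitivity (w0 ^+ 2 * (amin * S0 ^+ 2 + amax * C0 ^+ 2)); first by ring.
  by rewrite /w0 expr_div_n sqr_sqrtr ?(ltW V0_gt0) // divfK // gt_eqF.
have tauk : tau k = 0 by rewrite /tau (k_off erefl).1 (k_off erefl).2 !mul0r addr0.
have [x [y [lam [flow x0 y0 x1]]]] := foc tau tau_tan tau_norm.
have [L L_ge0 HL] := flow_lam_lipschitz amin_gt0 a_bd amax_gt0 T_gt0.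
pose A1 := L * (2 * T ^+ 2).
pose A2 := T ^+ 2 * expR (1 + T ^+ 2 * amax / amin / a k).
have A1_ge0 : 0 <= A1 by rewrite mulr_ge0 // mulr_ge0 ?sqr_ge0.
have A2_ge0 : 0 <= A2 by rewrite mulr_ge0 ?sqr_ge0 ?expR_ge0.
pose M := Num.sqrt (A1 * A2) * (b + g) / a k / shear_rate T (Num.sqrt (a k)) b g.
pose B := T ^+ 2 * l0 ^+ 2.
have B_gt0 : 0 < B by rewrite pmulr_rgt0 ?(exprn_gt0 2 T_gt0) // exprn_even_gt0.
(* Chosen so that [q <= 1] and [q M^2 < B], which contradicts the shear bound below. *)
pose q := B / (1 + B + M ^+ 2).
have den_gt0 : 0 < 1 + B + M ^+ 2 by rewrite ltr_wpDr ?sqr_ge0 // addr_gt0.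
have q_gt0 : 0 < q by rewrite divr_gt0.
have q_le1 : q <= 1.
  by rewrite /q ler_pdivrMr // mul1r -addrA addrC -addrA lerDl addr_ge0 ?sqr_ge0.
have qM : q * M ^+ 2 < B.
  rewrite /q mulrAC ltr_pdivrMr // ltr_pM2l // ltrDr.
  by rewrite addr_gt0.
pose sg := Num.sqrt q; pose r := Num.sqrt (1 - q).
have sg2 : sg ^+ 2 = q by rewrite sqr_sqrtr // ltW.
have r2 : r ^+ 2 = 1 - q by rewrite sqr_sqrtr // subr_ge0.
have r_ge0 : 0 <= r by exact: sqrtr_ge0.
(* [r^2 + sg^2 = 1] and [tau_k = 0], so the tilted velocity still has norm [T]. *)
pose v j := r * tau j + (sg * T) * (j == k)%:R.
have sum_delta (F : 'I_n -> R) : \sum_j F j * (j == k)%:R = F k.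
  rewrite (bigD1 k) //= eqxx mulr1 big1 ?addr0 // => j /negbTE ->.
  by rewrite mulr0.
have v_tan : \sum_j u j * v j / a j = 0.
  have -> : \sum_j u j * v j / a j = r * (\sum_j u j * tau j / a j) +
      \sum_j (sg * T * u j / a j) * (j == k)%:R.
    by rewrite mulr_sumr -big_split; apply: eq_bigr => j _ /=; rewrite /v; ring.
  by rewrite tau_tan sum_delta uk // !mulr0 mul0r addr0.
have v_norm : \sum_j v j ^+ 2 = T ^+ 2.
  have -> : \sum_j v j ^+ 2 = r ^+ 2 * (\sum_j tau j ^+ 2) +
      \sum_j (2 * r * (sg * T) * tau j + (sg * T) ^+ 2 * (j == k)%:R) * (j == k)%:R.
    by rewrite mulr_sumr -big_split; apply: eq_bigr => j _ /=; rewrite /v; ring.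
  rewrite tau_norm (sum_delta (fun j => 2 * r * (sg * T) * tau j + (sg * T) ^+ 2 * (j == k)%:R)).
  by rewrite tauk eqxx mulr1 mulr0 add0r exprMn sg2 r2; ring.
have [x' [y' [lam' [flow' x'0 y'0 x'1]]]] := foc v v_tan v_norm.
have vk : v k = sg * T by rewrite /v tauk eqxx mulr0 add0r mulr1.
have [dx' dy' _ _ _] := flow'.
have E0 : \sum_j ((x j 0 - x' j 0) ^+ 2 + (y j 0 - y' j 0) ^+ 2) <= 2 * T ^+ 2 * q.
  have -> : \sum_j ((x j 0 - x' j 0) ^+ 2 + (y j 0 - y' j 0) ^+ 2) =
      (1 - r) ^+ 2 * (\sum_j tau j ^+ 2) +
      \sum_j (- (2 * (1 - r) * (sg * T)) * tau j + (sg * T) ^+ 2 * (j == k)%:R) * (j == k)%:R.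
    rewrite mulr_sumr -big_split; apply: eq_bigr => j _ /=.
    by rewrite x0 x'0 y0 y'0 /v -/w0 -/(tau j); ring.
  rewrite tau_norm (sum_delta (fun j => - (2 * (1 - r) * (sg * T)) * tau j + (sg * T) ^+ 2 * (j == k)%:R)).
  rewrite tauk eqxx exprMn sg2 mulr0 add0r mulr1.
  have r_le1 : r <= 1 by rewrite -sqrtr1 ler_sqrt // gerBl ltW.
  have -> : (1 - r) ^+ 2 * T ^+ 2 + q * T ^+ 2 = ((1 - r) ^+ 2 + q) * T ^+ 2 by ring.
  have -> : 2 * T ^+ 2 * q = (q + q) * T ^+ 2 by ring.
  rewrite ler_wpM2r ?sqr_ge0 // lerD2r.
  have -> : q = 1 - r ^+ 2 by rewrite r2; ring.
  have : 0 <= r * (1 - r) by rewrite mulr_ge0 // subr_ge0.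
  by nra.
have lam_le t : 0 <= t <= 1 -> (lam t - lam' t) ^+ 2 <= A1 * q.
  move=> t01; apply: le_trans (HL _ _ _ _ _ _ flow flow' t t01) _.
  by rewrite /A1 -mulrA ler_wpM2l.
have X_le t : 0 <= t <= 1 -> x' k t ^+ 2 <= A2 * q.
  move=> /andP[t0 t1].
  have lamn := flow_lam_norm amin_gt0 a_bd flow' T_gt0 amax_gt0.
  have := hill_energy_le (a_gt0 k) lamn (dx' k) (dy' k) t0.
  rewrite x'0 uk // y'0 vk expr0n add0r exprMn sg2 => h.
  apply: le_trans (_ : x' k t ^+ 2 + y' k t ^+ 2 <= _); first by rewrite lerDl sqr_ge0.
  apply: le_trans h _; rewrite /A2 [leRHS]mulrC [leRHS]mulrA.
  have qT : 0 <= q * T ^+ 2 by rewrite mulr_ge0 ?sqr_ge0 // ltW.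
  apply: (ler_wpM2l qT); rewrite ler_expR ler_piMr // addr_ge0 //.
  have ak0 := ltW (a_gt0 k); have am0 := ltW amin_gt0; have aM0 := ltW amax_gt0.
  by rewrite divr_ge0 // divr_ge0 // mulr_ge0 ?sqr_ge0.
have prod_le t : 0 <= t <= 1 -> `|(lam t - lam' t) * x' k t| <= Num.sqrt (A1 * A2) * q.
  move=> t01; have rhs0 : 0 <= Num.sqrt (A1 * A2) * q.
    by apply: mulr_ge0; [exact: sqrtr_ge0 | exact: ltW].
  rewrite -(ler_pXn2r (n := 2)) ?nnegrE // real_normK ?num_real //.
  rewrite [leLHS]exprMn [leRHS]exprMn sqr_sqrtr; last exact: mulr_ge0.
  have -> : A1 * A2 * q ^+ 2 = (A1 * q) * (A2 * q) by ring.
  by apply: ler_pM; rewrite ?sqr_ge0 ?lam_le ?X_le.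
have aligned j t : a j = a k -> x' k t * y' j t = x' j t * y' k t.
  move=> jk; have := flow_wronskian flow' (esym jk) t.
  by rewrite !x'0 !uk // !mul0r subrr => /eqP; rewrite subr_eq0 => /eqP.
(* As [u_k = 0], the Moser integral at both ends is [y'_k^2] times the same nonzero factor. *)
have speed_k : y' k 1 ^+ 2 = y' k 0 ^+ 2.
  have := moser_integral_const flow' a_gt0 aligned (flow_tangent amin_gt0 a_bd flow') 1 0.
  rewrite /moser_integral /moser_p x'0 x'1 uk // !mul0r !mulr0 !subr0.
  have -> : (fun j => x' j 1) = u by apply/funext.
  have -> : (fun j => x' j 0) = u by apply/funext.
  by rewrite !mulrA ![_ * (1 + _)]mulrC -!mulrA -!expr2 => /(mulfI resn).
have := plane_shear_bound flow x0 y0 x1 (dx' k) (dy' k).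
move=> /(_ (Num.sqrt (A1 * A2) * q)); rewrite x'0 x'1 uk // speed_k.
move=> /(_ erefl erefl erefl prod_le); rewrite y'0 vk -/b -/g -/l0.
have -> : Num.sqrt (A1 * A2) * q * (b + g) / a k / shear_rate T (Num.sqrt (a k)) b g = q * M.
  by rewrite /M; ring.
have -> : (sg * T) ^+ 2 * l0 ^+ 2 = q * B by rewrite exprMn sg2 /B; ring.
have -> : (q * M) ^+ 2 = q * (q * M ^+ 2) by ring.
by rewrite ler_pM2l // leNgt qM.
Qed.

End Extremal.

(** * Combination of the two cases *)

Lemma no_refocus (R : realType) (n : nat) (a u : 'I_n -> R) (T : R) (s : seq R) :
  (forall j, 0 < a j) -> uniq s -> (4 <= size s)%N ->
  (forall z, z \in s -> exists j, a j = z) ->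
  \sum_j u j ^+ 2 / a j = 1 -> 0 < T -> ~ refocuses a T u.
Proof.
move=> a_gt0 us s4 sa u1 T_gt0 foc.
have [j0 _] : exists j, a j = nth 0 s 0.
  by apply: sa; apply: mem_nth; apply: leq_trans s4.
have [i _ i_min] := @arg_minP _ _ _ j0 xpredT a isT.
have [l _ l_max] := @arg_maxP _ _ _ j0 xpredT a isT.
have a_bd j : a i <= a j <= a l by apply/andP; split; [exact: i_min | exact: l_max].
(* Discarding the two extreme values leaves at least two distinct intermediate eigenvalues. *)
pose s' := rem (a l) (rem (a i) s).
have s'2 : (2 <= size s')%N.
  have rem_size (z : R) (r : seq R) : (size r <= (size (rem z r)).+1)%N.
    have [zr|zr] := boolP (z \in r); last by rewrite rem_id.
    by rewrite size_rem //; case: (size r).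
  have := rem_size (a i) s; have := rem_size (a l) (rem (a i) s); rewrite -/s'.
  by rewrite -ltnS => h1 h2; have := leq_trans s4 (leq_trans h2 h1); rewrite !ltnS.
have us' : uniq s' by rewrite !rem_uniq.
have mid z : z \in s' -> exists k, [/\ a k = z, a i < a k & a k < a l].
  rewrite mem_rem_uniq ?rem_uniq // inE => /andP[zl].
  rewrite mem_rem_uniq // inE => /andP[zi /sa[k ak]]; exists k.
  have /andP[h1 h2] := a_bd k.
  by rewrite !lt_neqAle h1 h2 ak eq_sym zi zl.
have [k [kE ik kl]] := mid _ (mem_nth 0 (ltnW s'2)).
have [k' [k'E ik' kl']] := mid _ (mem_nth 0 s'2).
have kk' : a k != a k' by rewrite kE k'E nth_uniq // ltnW.
have u_mid j : a i < a j -> a j < a l -> u j = 0.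
  move=> ij jl; apply/eqP; apply/negPn/negP => uj.
  exact: (no_refocus_noncritical (a_gt0 i) a_bd (a_gt0 l) T_gt0 uj u1 ij jl foc).
have il : a i < a l := lt_trans ik kl.
have [P [C0 [Ps P2 uP]]] := eigen_axis u (a_gt0 i) (erefl (a i)).
have [Q [S0 [Qs Q2 uQ]]] := eigen_axis u (a_gt0 l) (erefl (a l)).
have uE j : u j = P j * C0 + Q j * S0.
  have /andP[h1 h2] := a_bd j.
  have [ji|ji] := eqVneq (a j) (a i).
    by rewrite (Qs j) ?mul0r ?addr0 ?uP // ji lt_eqF.
  have [jl|jl] := eqVneq (a j) (a l).
    by rewrite (Ps j) ?mul0r ?add0r ?uQ.
  rewrite (Ps j) // (Qs j) // !mul0r addr0 u_mid // lt_neqAle ?h1 ?h2 ?andbT //.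
  by rewrite eq_sym.
have F r := refocus_focal (a_gt0 i) a_bd il T_gt0 Ps Qs P2 Q2 uE u1 (k := r).
have E1 := F k ik kl foc; have E2 := F k' ik' kl' foc.
have circ := extremal_circle (a_gt0 i) il Ps Qs P2 Q2 uE u1.
(* Since [C0^2 + S0^2 = 1], [E1] amounts to [a k = a l C0^2 + a i S0^2], and [E2] gives [a k'] the
   same value. *)
case/eqP: kk'; apply/eqP; rewrite -subr_eq0; apply/eqP.
transitivity ((a k - a k') * (C0 ^+ 2 + S0 ^+ 2)); first by rewrite circ mulr1.
by nra.
Qed.

(** * Reduction to eigencoordinates *)

Section EigenCoordinates.
Variables (R : realType) (n : nat) (P : 'M[R]_n) (d : 'rV[R]_n).
Hypothesis PP : P *m P^T = 1%:M.
Let A := P^T *m diag_mx d *m P.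
Hypothesis A_pos : posdef_mx A.

Definition coord (v : 'cV[R]_n) (j : 'I_n) : R := (P *m v) j 0.
Definition of_coord (v : 'I_n -> R) : 'cV[R]_n := P^T *m \col_j v j.

Let a j := d 0 j.

Lemma coord_of v j : coord (of_coord v) j = v j.
Proof. by rewrite /coord /of_coord mulmxA PP mul1mx mxE. Qed.

Lemma of_coordK v : of_coord (coord v) = v.
Proof.
rewrite /of_coord /coord -[RHS]mul1mx -(mulmx1C PP) -mulmxA; congr (_ *m _).
by apply/colP => j; rewrite mxE.
Qed.

Lemma coord_inj v w : (forall j, coord v j = coord w j) -> v = w.
Proof. by move=> vw; rewrite -(of_coordK v) -(of_coordK w); congr of_coord; apply/funext. Qed.

Lemma coordE v j : coord v j = \sum_k P j k * v k 0.
Proof. by rewrite /coord mxE. Qed.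

Lemma dot_coord v w : dot v w = \sum_j coord v j * coord w j.
Proof.
have dotE (x y : 'cV[R]_n) : dot x y = (x^T *m y) 0 0.
  by rewrite mxE; apply: eq_bigr => j _; rewrite mxE.
have -> : \sum_j coord v j * coord w j = dot (P *m v) (P *m w) by [].
by rewrite !dotE trmx_mul mulmxA -(mulmxA v^T) (mulmx1C PP) mulmx1.
Qed.

Lemma coord_A v j : coord (A *m v) j = a j * coord v j.
Proof. by rewrite /coord /A !mulmxA PP mul1mx -mulmxA mul_diag_mx mxE. Qed.

Lemma eigen_gt0 j : 0 < a j.
Proof.
pose v := of_coord (fun i => (i == j)%:R).
have v0 : v != 0.
  apply/eqP => v0; have := coord_of (fun i => (i == j)%:R) j.
  by rewrite -/v v0 /coord mulmx0 mxE eqxx => /esym/eqP; rewrite oner_eq0.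
have := A_pos v0; rewrite dot_coord (bigD1 j) //= big1 => [|i ij].
  by rewrite coord_A coord_of eqxx !mulr1 addr0.
by rewrite coord_A coord_of (negbTE ij) !mulr0.
Qed.

Lemma coord_invA v j : coord (invmx A *m v) j = coord v j / a j.
Proof.
have an i : a i != 0 by rewrite gt_eqF // eigen_gt0.
suff -> : invmx A *m v = of_coord (fun j => coord v j / a j) by rewrite coord_of.
have Au : A \in unitmx.
  rewrite -row_free_unit -kermx_eq0; apply/rowV0P => r /sub_kermxP rA.
  apply: trmx_inj; rewrite trmx0; apply: coord_inj => i.
  have Asym : A^T = A by rewrite /A !trmx_mul trmxK tr_diag_mx mulmxA.
  have : A *m r^T = 0 by rewrite -[A]Asym -trmx_mul rA trmx0.
  move=> /(congr1 (fun w => coord w i)); rewrite coord_A.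
  have -> : coord 0 i = 0 by rewrite /coord mulmx0 mxE.
  by move=> /eqP; rewrite mulf_eq0 (negbTE (an i)) => /eqP.
apply: (canLR (mulKmx Au)); apply: coord_inj => i.
by rewrite coord_A coord_of mulrC divfK.
Qed.

Lemma dot_invA v w : dot (invmx A *m v) w = \sum_j coord v j * coord w j / a j.
Proof.
by rewrite dot_coord; apply: eq_bigr => j _; rewrite coord_invA mulrAC.
Qed.

Lemma ellipsoidE x : ellipsoid A x <-> \sum_j coord x j ^+ 2 / a j = 1.
Proof.
rewrite /ellipsoid /= dot_invA.
by under [in X in _ <-> X]eq_bigr do rewrite expr2.
Qed.

Lemma coord_lin p q v w j : coord (p *: v + q *: w) j = p * coord v j + q * coord w j.
Proof. by rewrite /coord mulmxDr -!scalemxAr !mxE. Qed.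

Lemma coord_derive (g : R -> 'cV[R]_n) (t : R) j : derivable g t 1 ->
  is_derive t 1 (fun s => coord (g s) j) (coord (derive1 g t) j).
Proof.
move=> dg; under [X in is_derive _ _ X]eq_fun do rewrite coordE.
rewrite coordE.
have dgk k : is_derive t 1 (fun s => g s k 0) (derive1 g t k 0).
  rewrite derive1E derive_mx // mxE; apply: derivableP.
  by move/derivable_mxP: dg; apply.
der; apply: eq_bigr => k _; ring.
Qed.

(** Supplies the tangent vectors against which the geodesic equation is tested and the unit
    directions to which self-focality is applied. *)
Lemma tangent_of_orthogonal x v : ellipsoid A x ->
  \sum_j coord x j * coord v j / a j = 0 -> tangent_space (ellipsoid A) x v.
Proof.
move=> /ellipsoidE x1 xv.
(* Inverse stereographic projection gives a rational curve on the ellipsoid. *)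
pose m := (\sum_j coord v j ^+ 2 / a j) / 4.
have m0 : 0 <= m.
  by rewrite divr_ge0 // sumr_ge0 // => j _; rewrite divr_ge0 ?sqr_ge0 // ltW // eigen_gt0.
have den (t : R) : 1 + m * t ^+ 2 != 0.
  by rewrite gt_eqF // ltr_wpDr // mulr_ge0 // sqr_ge0.
pose p t := (1 - m * t ^+ 2) / (1 + m * t ^+ 2); pose q t := t / (1 + m * t ^+ 2).
pose c t : 'cV[R]_n := p t *: x + q t *: v.
have dc k : is_derive (0 : R) 1 (fun t => c t k 0) (v k 0).
  have -> : (fun t => c t k 0) = fun t => p t * x k 0 + q t * v k 0.
    by apply/funext => t; rewrite !mxE.
  have d0 := den 0; rewrite /p /q; der.
  by field.
have dcv : derivable c 0 1.
  by apply/derivable_mxP => k o; rewrite ord1; have [] := dc k.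
exists c; split => //.
- move=> t; apply/ellipsoidE.
  have -> : \sum_j coord (c t) j ^+ 2 / a j = p t ^+ 2 * (\sum_j coord x j ^+ 2 / a j) +
     2 * p t * q t * (\sum_j coord x j * coord v j / a j) +
     q t ^+ 2 * (\sum_j coord v j ^+ 2 / a j).
    rewrite !mulr_sumr -!big_split; apply: eq_bigr => j _ /=.
    by rewrite coord_lin; ring.
  rewrite x1 xv mulr0 addr0 mulr1.
  have -> : \sum_j coord v j ^+ 2 / a j = 4 * m by rewrite /m; field.
  by rewrite /p /q; field; exact: den.
- by rewrite /c /p /q expr0n mulr0 subr0 addr0 divr1 mul0r scale0r addr0 scale1r.
- rewrite derive1E derive_mx //; apply/colP => k; rewrite mxE.
  by have [_ ->] := dc k.
Qed.

(** The acceleration is orthogonal to the tangent space, hence a multiple [mu] of the normal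
    [A^-1 x]; differentiating the constraint twice identifies [mu] as [- lam]. *)
Lemma geodesic_flow g T : geodesic (ellipsoid A) g ->
  dot (derive1 g 0) (derive1 g 0) = T ^+ 2 ->
  exists lam, ellipsoid_flow a T (fun j t => coord (g t) j)
    (fun j t => coord (derive1 g t) j) lam.
Proof.
move=> [gM dg ddg acc] speed0.
pose x j t := coord (g t) j; pose y j t := coord (derive1 g t) j.
pose z j t := coord (derive1 (derive1 g) t) j.
have dx j (t : R) : is_derive t 1 (x j) (y j t) by exact: coord_derive.
have dy j (t : R) : is_derive t 1 (y j) (z j t) by exact: coord_derive.
have x1 t : \sum_j x j t ^+ 2 / a j = 1 by apply/ellipsoidE.
have an i : a i != 0 by rewrite gt_eqF // eigen_gt0.
have cst_der (f : R -> R) (c e t : R) : (forall s, f s = c) -> is_derive t 1 f e -> e = 0.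
  by move=> fc [_ <-]; have -> : f = cst c by [apply/funext]; rewrite derive_cst.
have xy t : \sum_j x j t * y j t / a j = 0.
  have h : is_derive t 1 (fun t => \sum_j x j t ^+ 2 / a j) (2 * \sum_j x j t * y j t / a j).
    by der; rewrite mulr_sumr; apply: eq_bigr => j _; ring.
  by have /eqP := cst_der _ _ _ _ x1 h; rewrite mulf_eq0 pnatr_eq0 => /eqP.
have yz t : \sum_j y j t ^+ 2 / a j + \sum_j x j t * z j t / a j = 0.
  have h : is_derive t 1 (fun t => \sum_j x j t * y j t / a j)
      (\sum_j y j t ^+ 2 / a j + \sum_j x j t * z j t / a j).
    by der; rewrite -big_split; apply: eq_bigr => j _ /=; ring.
  exact: cst_der xy h.
pose D t := \sum_j x j t ^+ 2 / a j ^+ 2.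
have D_gt0 t : 0 < D t.
  rewrite lt_neqAle sumr_ge0 ?andbT => [|j _]; last by rewrite divr_ge0 ?sqr_ge0.
  rewrite eq_sym psumr_eq0 => [|j _]; last by rewrite divr_ge0 ?sqr_ge0.
  apply/negP => /allP al; have := x1 t; rewrite big1 => [/esym/eqP|j _].
    by rewrite oner_eq0.
  have := al j; rewrite mem_index_enum => /(_ isT).
  by rewrite mulf_eq0 invr_eq0 !sqrf_eq0 (negbTE (an j)) orbF => /eqP ->; rewrite expr0n mul0r.
pose mu t := (\sum_j z j t * (x j t / a j)) / D t.
have zE j t : z j t = mu t * (x j t / a j).
  (* The tangential part of the acceleration is orthogonal to the normal and, by the geodesic
     equation, to the acceleration; hence it is orthogonal to itself. *)
  pose w i := z i t - mu t * (x i t / a i).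
  have bw : \sum_i x i t * w i / a i = 0.
    have -> : \sum_i x i t * w i / a i = \sum_i z i t * (x i t / a i) - mu t * D t.
      by rewrite /D mulr_sumr -sumrB; apply: eq_bigr => i _; rewrite /w; field.
    by rewrite /mu divfK ?subrr // gt_eqF.
  have zw : \sum_i z i t * w i = 0.
    have := acc t (of_coord w); rewrite dot_coord => h.
    under eq_bigr do rewrite -(coord_of w); apply: h.
    apply: tangent_of_orthogonal => //.
    by under eq_bigr do rewrite coord_of.
  have : \sum_i w i ^+ 2 = 0.
    have -> : \sum_i w i ^+ 2 = \sum_i z i t * w i - mu t * \sum_i x i t * w i / a i.
      rewrite mulr_sumr -sumrB; apply: eq_bigr => i _.
      by rewrite expr2 -[X in X * _]/(z i t - mu t * (x i t / a i)); field.
    by rewrite zw bw mulr0 subrr.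
  move=> /eqP; rewrite psumr_eq0 => [/allP/(_ j)|i _]; last exact: sqr_ge0.
  rewrite mem_index_enum sqrf_eq0 => /(_ isT).
  by rewrite /w subr_eq0 => /eqP.
clearbody mu; pose lam t := (\sum_j y j t ^+ 2 / a j) / D t.
have muE t : mu t = - lam t.
  have xz : \sum_j x j t * z j t / a j = mu t * D t.
    by rewrite /D [RHS]mulr_sumr; apply: eq_bigr => j _; rewrite zE; field.
  apply: (mulIf (x := D t)); first by rewrite gt_eqF.
  rewrite mulNr /lam divfK ?gt_eqF //.
  by have := yz t; rewrite xz addrC => /eqP; rewrite addr_eq0 => /eqP.
exists lam; split.
- exact: dx.
- move=> j t; apply: der_eq (dy j t) _; rewrite zE muE -[RHS]/(- (lam t / a j) * x j t); ring.
- exact: x1.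
- move=> t; rewrite -speed0 dot_coord.
  under [RHS]eq_bigr do rewrite -expr2.
  apply: (der0_cst (f := fun t => \sum_j y j t ^+ 2)) => s; der.
  transitivity (2 * mu s * \sum_j x j s * y j s / a j); last by rewrite xy mulr0.
  by rewrite mulr_sumr; apply: eq_bigr => j _; rewrite zE; ring.
- by [].
Qed.

Lemma self_focal_refocuses x0 : self_focal (ellipsoid A) x0 ->
  \sum_j coord x0 j ^+ 2 / a j = 1 /\ exists2 T, 0 < T & refocuses a T (coord x0).
Proof.
move=> [Mx0 [T [T_gt0 foc]]]; split; first exact/ellipsoidE.
exists T => // v v_tan v_norm.
have Tn : T != 0 by rewrite gt_eqF.
pose xi := T^-1 *: of_coord v.
have coord_xi j : coord xi j = T^-1 * v j.
  by rewrite /xi -[_ *: _]addr0 -(scale0r (0 : 'cV_n)) coord_lin coord_of mul0r addr0.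
have [|g [geo g0 dg0 g1]] := foc xi.
  split.
    apply: tangent_of_orthogonal => //.
    under eq_bigr do rewrite coord_xi mulrCA -mulrA.
    by rewrite -mulr_sumr v_tan mulr0.
  rewrite dot_coord; under eq_bigr do rewrite coord_xi -expr2 exprMn.
  by rewrite -mulr_sumr v_norm exprVn mulVf // expf_neq0.
have dg0E : derive1 g 0 = of_coord v by rewrite dg0 /xi scalerA divff // scale1r.
have [|lam flow] := geodesic_flow (T := T) geo.
  rewrite dg0E dot_coord -v_norm; apply: eq_bigr => j _.
  by rewrite coord_of expr2.
exists (fun j t => coord (g t) j), (fun j t => coord (derive1 g t) j), lam.
split => // j; rewrite ?g0 ?g1 //.
by rewrite dg0E coord_of.
Qed.

Lemma eigenvalue_coord z : eigenvalue A z -> exists j, a j = z.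
Proof.
move=> /eigenvalueP[v vA v0].
have Asym : A^T = A by rewrite /A !trmx_mul trmxK tr_diag_mx mulmxA.
have Av : A *m v^T = z *: v^T by rewrite -[A]Asym -trmx_mul vA linearZ.
have [/existsP[j vj]|/existsPn v'0] := boolP [exists j, coord v^T j != 0].
  exists j; have := congr1 (fun w => coord w j) Av.
  rewrite coord_A -[z *: _]addr0 -(scale0r (0 : 'cV_n)) coord_lin mul0r addr0.
  exact: mulIf.
case/eqP: v0; apply: trmx_inj; rewrite trmx0; apply: coord_inj => j.
have -> : coord 0 j = 0 by rewrite /coord mulmx0 mxE.
by apply/eqP/negPn; exact: v'0.
Qed.

End EigenCoordinates.

Theorem theorem0p1 (R : realType) (n : nat) (A : 'M[R]_n)
    (A_sym : A^T = A) (A_pos : posdef_mx A)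
    (A_eig : exists s : seq R,
       [/\ uniq s, (4 <= size s)%N & all (eigenvalue A) s]) :
  ~ exists x0 : 'cV[R]_n, self_focal (ellipsoid A) x0.
Proof.
case=> x0 foc; have [s [us s4 /allP sA]] := A_eig.
have [P [d [PP AE]]] := symmetric_spectral A_sym; subst A.
have [x1 [T T_gt0 refoc]] := self_focal_refocuses PP A_pos foc.
apply: (no_refocus (eigen_gt0 PP A_pos) us s4 _ x1 T_gt0 refoc) => z /sA.
exact: eigenvalue_coord.
Qed.
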